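(* Let $(R,\mathfrak m)$ be a Noetherian local ring of dimension $d\ge1$ and let $\varphi:R\to S$ be a finite homomorphism, where $S$ is a Cohen-Macaulay ring. Let $I$ be an $\mathfrak m$-primary ideal of $R$ with a minimal reduction $Q$. Let $\nu_R(S)$ denote the minimal number of generators of $S$ as an $R$-module. Then: (1) if $\dim S_Q(I)<d$, then $S_{QS}(IS)=0$; (2) if $\mathrm s_{QS}(IS)\ne0$, then $\dim S_Q(I)=d$; (3) $\mathrm s_{QS}(IS)\le \nu_R(S)\cdot \mathrm s_Q(I)$.
   Context: $\lambda(\cdot)$ denotes length over $R$. A minimal reduction of an $\mathfrak m$-primary ideal $I$ of a $d$-dimensional local ring is an ideal $Q=(a_1,\dots,a_d)\subset I$ with $I^{n+1}=QI^n$ for some $n\ge0$. The Sally module of $I$ relative to $Q$ is the graded module $S_Q(I)=\bigoplus_{n\ge1} I^{n+1}/IQ^n$ over the Rees algebra $R[QT]$ of $Q$; it is finitely generated of dimension at most $d$. The Sally module of $IS$ relative to $QS$ is defined in the same manner as the graded module $S_{QS}(IS)=\bigoplus_{n\ge1} I^{n+1}S/IQ^nS$. The multiplicity $\mathrm s_Q(I)=\mathrm e_0((QT),S_Q(I))$ is the integer with $\lambda(I^{n+1}/IQ^n)=\mathrm s_Q(I)\binom{n+d-1}{d-1}+\text{lower degree terms}$ for $n\gg0$ (it is $0$ when $\dim S_Q(I)<d$), and $\mathrm s_{QS}(IS)$ is defined in the same way from $\lambda(I^{n+1}S/IQ^nS)$, with lengths taken over $R$.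
   Formalization: In (1) it is additionally assumed that every maximal ideal of S has height d (S is maximal Cohen-Macaulay over R); without it (1) fails, e.g. R=k[[x,y]]×_k k[[t^3,t^4]], I=m, Q=(x+t^3,y), S=k[[t^3,t^4]]. Parts (2) and (3) are unchanged. *)

(* Defs.v *)
(* MathComp (algebra) with the classical sets of MathComp-Analysis. *)
From HB Require Import structures.
From mathcomp Require Import all_boot all_order all_algebra.
From mathcomp Require Import boolp classical_sets.
Set Implicit Arguments.
Unset Strict Implicit.
Unset Printing Implicit Defensive.
Import GRing.Theory Num.Theory.
Local Open Scope classical_set_scope.
Local Open Scope ring_scope.

(* Strictly increasing chains C_0 < ... < C_n (so of length n) in a family of
   sets.  The supremum of the lengths of such chains is n iff [max_chain _ n],
   and is < n iff [~ has_chain _ n]; the latter includes the case of an empty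
   family, whose supremum is -oo. *)
Definition has_chain (T : Type) (C : set (set T)) (n : nat) : Prop :=
  exists N : nat -> set T,
    (forall i, (i <= n)%N -> C (N i)) /\ (forall i, (i < n)%N -> N i `<` N i.+1).

Definition max_chain (T : Type) (C : set (set T)) (n : nat) : Prop :=
  has_chain C n /\ ~ has_chain C n.+1.

Section Modules.
Variables (R : comNzRingType) (M : lmodType R).

Definition submodule (N : set M) : Prop :=
  [/\ N 0, forall x y, N x -> N y -> N (x + y)
    & forall (a : R) x, N x -> N (a *: x)].

Definition span (X : set M) : set M := smallest submodule X.

Definition module_finite : Prop := exists s : seq M, span [set` s] = setT.

Definition min_number_generators (n : nat) : Prop :=
  (exists s : seq M, size s = n /\ span [set` s] = setT) /\
  (forall s : seq M, span [set` s] = setT -> (n <= size s)%N).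

(* A quotient module A/B is given by submodules B `<=` A of M; its submodules
   are then the N/B with B `<=` N `<=` A. *)

Definition quot_length (A B : set M) (n : nat) : Prop :=
  max_chain [set N | [/\ submodule N, B `<=` N & N `<=` A]] n.

Definition quot_ann (A B : set M) : set R :=
  [set a | forall x, A x -> B (a *: x)].

(* For quotients A_n/B_n of finite length,
   length (A_n/B_n) = s * 'C(n + d - 1, d - 1) + (polynomial in n of degree
   < d - 1) for n large. *)
Definition hilbert_multiplicity (d : nat) (A B : nat -> set M) (s : int) : Prop :=
  exists p : {poly rat}, (size p < d)%N /\
  exists n0 : nat, forall n, (n0 <= n)%N ->
  exists l : nat, quot_length (A n) (B n) l /\
    l%:R = s%:~R * 'C(n + d - 1, d - 1)%:R + p.[n%:R].

End Modules.

Section Ideals.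
Variable R : comNzRingType.

Definition ideal (J : set R) : Prop := submodule (J : set R^o).

Definition ideal_gen (X : set R) : set R := span (X : set R^o).

Definition ideal_mul (J K : set R) : set R :=
  ideal_gen [set x * y | x in J & y in K].

Definition ideal_exp (J : set R) (n : nat) : set R :=
  iter n (ideal_mul J) setT.

Definition noetherian : Prop :=
  forall J, ideal J -> exists s : seq R, J = ideal_gen [set` s].

Definition prime_ideal (P : set R) : Prop :=
  [/\ ideal P, ~ P 1 & forall x y, P (x * y) -> P x \/ P y].

Definition maximal_ideal (P : set R) : Prop :=
  [/\ ideal P, ~ P 1
    & forall J, ideal J -> ~ J 1 -> P `<=` J -> J = P].

Definition local_ring (m : set R) : Prop :=
  maximal_ideal m /\ forall P, maximal_ideal P -> P = m.

Definition radical (J : set R) : set R := [set x | exists n, J (x ^+ n)].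

Definition primary_ideal (J : set R) : Prop :=
  [/\ ideal J, ~ J 1
    & forall x y, J (x * y) -> J x \/ exists n, J (y ^+ n)].

Definition primary_to (m J : set R) : Prop :=
  primary_ideal J /\ radical J = m.

Definition minimal_reduction (d : nat) (J Q : set R) : Prop :=
  [/\ exists a : d.-tuple R, Q = ideal_gen [set` tval a],
      Q `<=` J
    & exists n, ideal_exp J n.+1 = ideal_mul Q (ideal_exp J n)].

Definition krull_dim (d : nat) : Prop := max_chain prime_ideal d.

Definition height (P : set R) (h : nat) : Prop :=
  max_chain [set P' | prime_ideal P' /\ P' `<=` P] h.

Definition regular_sequence (s : seq R) : Prop :=
  (forall i, (i < size s)%N -> forall x,
     ideal_gen [set` take i s] (s`_i * x) -> ideal_gen [set` take i s] x) /\
  ~ ideal_gen [set` s] 1.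

(* depth of the ideal P on the ring R itself *)
Definition depth (P : set R) (n : nat) : Prop :=
  (exists s, [/\ regular_sequence s, [set` s] `<=` P & size s = n]) /\
  (forall s, regular_sequence s -> [set` s] `<=` P -> (size s <= n)%N).

(* Cohen-Macaulay as in Kaplansky (Commutative Rings, 3-1) and Eisenbud
   (Commutative Algebra, 18.2); R need not be local. *)
Definition cohen_macaulay : Prop :=
  noetherian /\
  forall P, maximal_ideal P -> exists n, height P n /\ depth P n.

(* Krull dimension of the module A/B, i.e. of the ring R / ann (A/B). *)
Definition quot_support_primes (M : lmodType R) (A B : set M) : set (set R) :=
  [set P | prime_ideal P /\ quot_ann A B `<=` P].

Definition quot_dim (M : lmodType R) (A B : set M) (d : nat) : Prop :=
  max_chain (quot_support_primes A B) d.

Definition quot_dim_lt (M : lmodType R) (A B : set M) (d : nat) : Prop :=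
  ~ has_chain (quot_support_primes A B) d.

End Ideals.

(* The target of a ring morphism as a module over its source. *)
Definition restr (R S : comNzRingType) (phi : {rmorphism R -> S}) : Type := S.

Section Restriction.
Variables (R S : comNzRingType) (phi : {rmorphism R -> S}).

HB.instance Definition _ := GRing.Zmodule.on (restr phi).

Definition restr_scale (a : R) (x : restr phi) : restr phi := phi a * (x : S).

Fact restr_scaleA a b x :
  restr_scale a (restr_scale b x) = restr_scale (a * b) x.
Proof. by rewrite /restr_scale rmorphM mulrA. Qed.

Fact restr_scale1 : left_id 1 restr_scale.
Proof. by move=> x; rewrite /restr_scale rmorph1 mul1r. Qed.

Fact restr_scaleDr : right_distributive restr_scale +%R.
Proof. by move=> a x y; exact: mulrDr. Qed.

Fact restr_scaleDl x : {morph restr_scale^~ x : a b / a + b}.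
Proof. by move=> a b; rewrite /restr_scale rmorphD; exact: mulrDl. Qed.

HB.instance Definition _ := GRing.Zmodule_isLmodule.Build R (restr phi)
  restr_scaleA restr_scale1 restr_scaleDr restr_scaleDl.

Definition finite_morphism : Prop := module_finite (restr phi).

Definition ideal_ext (J : set R) : set S := ideal_gen (phi @` J).

End Restriction.

Section ReesAlgebra.
Variable R : comNzRingType.

Lemma ideal_gen_ideal (X : set R) : ideal (ideal_gen X).
Proof.
split=> [N [[]] //|x y Nx Ny N NP|a x Nx N NP].
- by case: (NP) => -[_ ND _] _; apply: ND; [exact: Nx | exact: Ny].
- by case: (NP) => -[_ _ NZ] _; apply: NZ; exact: Nx.
Qed.

Lemma ideal_gen_min (X J : set R) : ideal J -> X `<=` J -> ideal_gen X `<=` J.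
Proof. by move=> idJ XJ x; exact. Qed.

Lemma sub_ideal_gen (X : set R) : X `<=` ideal_gen X.
Proof. by move=> x Xx N [_]; exact. Qed.

Lemma ideal_exp_ideal (J : set R) n : ideal (ideal_exp J n).
Proof. by case: n => [|n]; [split | exact: ideal_gen_ideal]. Qed.

Lemma ideal_exp_mul (J : set R) i j x y :
  ideal_exp J i x -> ideal_exp J j y -> ideal_exp J (i + j) (x * y).
Proof.
move=> + Jy; elim: i x => [|i IH] x Jx.
  by have [_ _ JZ] := ideal_exp_ideal J j; exact: JZ.
rewrite addSn.
have [J0 JD JZ] := ideal_exp_ideal J (i + j).+1.
apply: (@ideal_gen_min _ [set z | ideal_exp J (i + j).+1 (z * y)] _ _ x Jx).
  split=> /= [|u v|a u] ; first by rewrite mul0r.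
  - by rewrite mulrDl; exact: JD.
  - by move=> Ju; rewrite -[a *: u]/(a * u) -mulrA; exact: JZ.
move=> _ [u Ju [v Jv <-]] /=; rewrite -mulrA; apply: sub_ideal_gen.
by exists u => //; exists (v * y) => //; exact: IH.
Qed.

Definition rees_pred (Q : set R) : {pred {poly R}} :=
  [pred p : {poly R} | `[< forall i, ideal_exp Q i p`_i >]].

Fact rees_subring (Q : set R) : subring_closed (rees_pred Q).
Proof.
split=> [|p q /asboolP Qp /asboolP Qq|p q /asboolP Qp /asboolP Qq]; apply/asboolP.
- case=> [|i] //; rewrite coef1 /=.
  by case: (ideal_exp_ideal Q i.+1).
- move=> i; have [_ QD QZ] := ideal_exp_ideal Q i; rewrite coefB.
  apply: QD => //; rewrite -mulN1r; exact: (QZ (-1)).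
- move=> i; have [Q0 QD QZ] := ideal_exp_ideal Q i; rewrite coefM.
  apply: (big_ind (ideal_exp Q i)) => // j _.
  by rewrite -[X in ideal_exp Q X](subnKC (leq_ord j)); exact: ideal_exp_mul.
Qed.

HB.instance Definition _ (Q : set R) :=
  GRing.isSubringClosed.Build {poly R} (rees_pred Q) (rees_subring Q).

(* The Rees algebra R[QT], the subring of R[T] of the polynomials whose
   coefficient of T^i lies in Q^i. *)
Record rees (Q : set R) : Type :=
  Rees { rees_val : {poly R}; _ : rees_val \in rees_pred Q }.

HB.instance Definition _ (Q : set R) := [isSub for @rees_val Q].
HB.instance Definition _ (Q : set R) := [Choice of rees Q by <:].
HB.instance Definition _ (Q : set R) :=
  [SubChoice_isSubComNzRing of rees Q by <:].

Definition rees_incl (Q : set R) : {rmorphism rees Q -> {poly R}} :=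
  (val : rees Q -> {poly R}).

End ReesAlgebra.

(* The Sally module is the quotient sally_num J / sally_den J Q of
   R[QT]-submodules of R[T], where x in J^(n+1) or J Q^n is written x T^n. *)
Definition sally_num (R : comNzRingType) (J : set R) : set {poly R} :=
  [set p | p`_0 = 0 /\ forall n, (1 <= n)%N -> ideal_exp J n.+1 p`_n].

Definition sally_den (R : comNzRingType) (J Q : set R) : set {poly R} :=
  [set p | p`_0 = 0 /\
     forall n, (1 <= n)%N -> ideal_mul J (ideal_exp Q n) p`_n].

Definition sally_zero (R : comNzRingType) (J Q : set R) : Prop :=
  sally_num J `<=` sally_den J Q.

Definition sally_dim (R : comNzRingType) (J Q : set R) (d : nat) : Prop :=
  @quot_dim (rees Q) (restr (rees_incl Q)) (sally_num J) (sally_den J Q) d.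

Definition sally_dim_lt (R : comNzRingType) (J Q : set R) (d : nat) : Prop :=
  @quot_dim_lt (rees Q) (restr (rees_incl Q)) (sally_num J) (sally_den J Q) d.

Definition sally_multiplicity (R : comNzRingType) (d : nat) (J Q : set R)
    (s : int) : Prop :=
  @hilbert_multiplicity R R^o d (fun n => ideal_exp J n.+1)
    (fun n => ideal_mul J (ideal_exp Q n)) s.

(* s_{QS}(JS); as in the definition, the lengths are over R and not over S. *)
Definition sally_multiplicity_ext (R S : comNzRingType)
    (phi : {rmorphism R -> S}) (d : nat) (J Q : set R) (s : int) : Prop :=
  @hilbert_multiplicity R (restr phi) d
    (fun n => ideal_exp (ideal_ext phi J) n.+1)
    (fun n => ideal_mul (ideal_ext phi J) (ideal_exp (ideal_ext phi Q) n)) s.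

(* Main.v *)
From mathcomp Require Import all_boot all_order all_algebra.
From mathcomp Require Import boolp classical_sets.
From mathcomp Require Import mpoly zify ring.
Require Import Defs.
Set Implicit Arguments.
Unset Strict Implicit.
Import Order.TTheory GRing.Theory Num.Theory.
Local Open Scope ring_scope.

(** The Sally module of [I] is a finitely generated graded module over the Rees
    algebra [R[QT]], which is a quotient of [R[X_1..X_d]] by way of the generators
    [a_1, .., a_d] of [Q]. A power of [m] kills it, so everything is decided by
    one question: is it annihilated by the value at [a] of a form [F] with a
    coefficient outside [m]?

    If there is no such form, the kernel of the presentation and the annihilator
    of the Sally module both consist of classes of polynomials with coefficients
    in [m]. The primes [(m, X_1, .., X_i)], for [i = 0, .., d], then descend to a
    chain of length [d] in the support ([sally_chain_or_form]). No chain is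
    longer: [d + 1] elements separating the members of such a chain would be
    algebraically dependent over the residue field, by a count of monomials
    ([sally_dim_bound]).

    If there is such a form, rewriting its leading monomial bounds the number of
    generators of the graded pieces, so that their lengths have order less than
    [n^(d-1)] ([sally_growth]). The generators of [S] over [R] give maps from
    [I^(n+1) / IQ^n] to [I^(n+1)S / IQ^nS] that are jointly surjective, hence a
    length is multiplied at most by the number of these generators
    ([sally_ext_length]). This proves (3) at once, and (2): a nonzero
    multiplicity means growth of order [n^(d-1)], which excludes the form.

    For (1) the form exists, since the dimension is less than [d]. A maximal ideal
    [P] of [S] contains a regular sequence of length [d], and locally at [P] the
    entries of this sequence have powers in [QS]. The depth sensitivity of the
    Koszul complex makes the complex on [a_1, .., a_d] acyclic at [P]
    ([kos_acyclic_regular]), hence globally; by Nakayama's lemma the sequence is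
    regular ([kos_exact_drop_regular]), and so it is quasi-regular
    ([quasi_regular]). The graded ring of [QS] being a polynomial ring, [F] acts on
    the direct sum of the [Q^nS / IQ^nS] as a nonzerodivisor, because its leading
    coefficient is a unit and the coefficients of the higher monomials are
    nilpotent ([quasi_regular_cancel]). As [F] maps [I^(n+1)S] into
    [IQ^(n+e)S], where [e] is its degree, [I^(n+1)S] lies in [IQ^nS]. *)


(** * Submodules *)

Section SubmoduleTheory.
Local Open Scope classical_set_scope.
Variables (R : comNzRingType) (M : lmodType R).
Implicit Types (N A B : set M) (X : set M).

Lemma submodule0 N : submodule N -> N 0. Proof. by case. Qed.

Lemma submoduleD N x y : submodule N -> N x -> N y -> N (x + y).
Proof. by case=> _ h _; exact: h. Qed.

Lemma submoduleZ N a x : submodule N -> N x -> N (a *: x).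
Proof. by case=> _ _ h; exact: h. Qed.

Lemma submoduleN N x : submodule N -> N x -> N (- x).
Proof. by move=> sN Nx; rewrite -scaleN1r; exact: submoduleZ. Qed.

Lemma submoduleB N x y : submodule N -> N x -> N y -> N (x - y).
Proof. by move=> sN Nx Ny; apply: submoduleD => //; exact: submoduleN. Qed.

Lemma submodule_sum N (I : Type) (r : seq I) (P : pred I) (F : I -> M) :
  submodule N -> (forall i, P i -> N (F i)) -> N (\sum_(i <- r | P i) F i).
Proof.
move=> sN NF; apply: (big_ind N) => //; first exact: submodule0.
by move=> x y; exact: submoduleD.
Qed.

Lemma span_submodule X : submodule (span X).
Proof.
split=> [N [[]] //|x y Nx Ny N NP|a x Nx N NP].
- by case: (NP) => sN _; apply: submoduleD => //; [exact: Nx | exact: Ny].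
- by case: (NP) => sN _; apply: submoduleZ => //; exact: Nx.
Qed.

Lemma sub_span X : X `<=` span X.
Proof. by move=> x Xx N [_]; exact. Qed.

Lemma span_min X N : submodule N -> X `<=` N -> span X `<=` N.
Proof. by move=> sN XN x; exact. Qed.

Lemma addset_submodule A B :
  submodule A -> submodule B -> submodule [set x + y | x in A & y in B].
Proof.
move=> sA sB; split.
- by exists 0; [exact: submodule0 | exists 0; [exact: submodule0 | rewrite addr0]].
- move=> _ _ [a Aa [b Bb <-]] [a' Aa' [b' Bb' <-]].
  exists (a + a'); first exact: submoduleD.
  by exists (b + b'); [exact: submoduleD | rewrite addrACA].
- move=> c _ [a Aa [b Bb <-]]; exists (c *: a); first exact: submoduleZ.
  by exists (c *: b); [exact: submoduleZ | rewrite scalerDr].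
Qed.

Lemma setI_submodule A B : submodule A -> submodule B -> submodule (A `&` B).
Proof.
move=> sA sB; split; first by split; exact: submodule0.
- by move=> x y [? ?] [? ?]; split; exact: submoduleD.
- by move=> c x [? ?]; split; exact: submoduleZ.
Qed.

Lemma span_seqP (s : seq M) x : span [set` s] x ->
  exists c : 'I_(size s) -> R, x = \sum_i c i *: s`_i.
Proof.
pose N := [set x | exists c : 'I_(size s) -> R, x = \sum_i c i *: s`_i].
move=> sx; apply: (span_min (N := N) _ _ sx); last first.
  move=> y /= ys.
  have ltis : (index y s < size s)%N by rewrite index_mem.
  exists (fun i => (i == Ordinal ltis)%:R).
  rewrite (bigD1 (Ordinal ltis)) //= eqxx scale1r nth_index // big1 ?addr0 //.
  by move=> i /negPf ->; rewrite scale0r.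
split.
- by exists (fun=> 0); rewrite big1 // => i _; rewrite scale0r.
- move=> _ _ [c ->] [c' ->]; exists (fun i => c i + c' i).
  by rewrite -big_split; apply: eq_bigr => i _; rewrite scalerDl.
- move=> a _ [c ->]; exists (fun i => a * c i).
  by rewrite scaler_sumr; apply: eq_bigr => i _; rewrite scalerA.
Qed.

End SubmoduleTheory.

(** * Lengths of quotients *)

Section Length.
Local Open Scope classical_set_scope.

Lemma has_chainW T (C : set (set T)) k n :
  (k <= n)%N -> has_chain C n -> has_chain C k.
Proof.
move=> lekn [N [CN ltN]]; exists N; split=> i lei.
  by apply: CN; exact: leq_trans lei lekn.
by apply: ltN; exact: leq_trans lei lekn.
Qed.

Lemma max_chain_uniq T (C : set (set T)) n p :
  max_chain C n -> max_chain C p -> n = p.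
Proof.
move=> [Cn nCn] [Cp nCp]; apply/eqP; rewrite eqn_leq.
apply/andP; split; rewrite leqNgt; apply/negP => lt.
  by apply: nCp; exact: has_chainW lt Cn.
by apply: nCn; exact: has_chainW lt Cp.
Qed.

(** Remembering the top of a chain is what lets chains be extended one step at
    a time. *)
Definition chain_to T (C : set (set T)) n (top : set T) : Prop :=
  exists N : nat -> set T, [/\ forall i, (i <= n)%N -> C (N i),
    forall i, (i < n)%N -> N i `<` N i.+1 & N n = top].

Lemma chain_to_has T (C : set (set T)) n top :
  chain_to C n top -> has_chain C n.
Proof. by case=> N [CN ltN _]; exists N. Qed.

Lemma chain_to0 T (C : set (set T)) top : C top -> chain_to C 0 top.
Proof. by move=> Ct; exists (fun=> top); split. Qed.

Lemma chain_toS T (C : set (set T)) n top top' :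
  chain_to C n top -> C top' -> top `<` top' -> chain_to C n.+1 top'.
Proof.
move=> [N [CN ltN <-]] Ct' lt; exists (fun i => if (i <= n)%N then N i else top').
split=> [i lei|i lei|]; last by rewrite ltnn.
  by case: leqP => // ?; exact: CN.
rewrite -ltnS lei; case: ltnP => [lt_in|le_ni]; first exact: ltN.
by have -> : i = n by apply/eqP; rewrite eqn_leq -ltnS lei.
Qed.

Variable R : comNzRingType.

Definition between (M : lmodType R) (A B : set M) : set (set M) :=
  [set N | [/\ submodule N, B `<=` N & N `<=` A]].

(** A bound on the length that does not presuppose that the length is finite and
    attained, and that is therefore stable under images and extensions. *)
Definition length_le (M : lmodType R) (A B : set M) (n : nat) : Prop :=
  ~ has_chain (between A B) n.+1.

Lemma quot_length_ge (M : lmodType R) (A B : set M) l n :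
  quot_length A B l -> length_le A B n -> (l <= n)%N.
Proof.
move=> [hl _] hn; rewrite leqNgt; apply/negP => lt; apply: hn.
exact: has_chainW lt hl.
Qed.

Lemma quot_length_le (M : lmodType R) (A B : set M) l :
  quot_length A B l -> length_le A B l.
Proof. by case. Qed.

Lemma length_le0 (M : lmodType R) (A B : set M) : A `<=` B -> length_le A B 0.
Proof.
move=> AB [N [CN ltN]]; have [_ B0 _] := CN 0%N isT; have [_ _ A1] := CN 1%N isT.
have [_] := ltN 0%N isT; apply => x /A1 /AB; exact: B0.
Qed.

(** Each strict step of a chain between [B] and [A] is strict after
    intersecting with [C] or after adding [C], by the modular law. *)
Lemma has_chain_split (M : lmodType R) (A B C : set M) k :
  submodule C -> B `<=` C -> C `<=` A -> submodule A ->
  has_chain (between A B) k ->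
  exists i j, [/\ (i + j)%N = k, has_chain (between C B) i
                & has_chain (between A C) j].
Proof.
move=> sC BC CA sA [N [CN ltN]].
pose I p := N p `&` C; pose S p := [set x + y | x in N p & y in C].
have CI p : (p <= k)%N -> between C B (I p).
  move=> /CN [sN BN NA]; split; first exact: setI_submodule.
    by move=> x Bx; split; [exact: BN | exact: BC].
  by move=> x [].
have CS p : (p <= k)%N -> between A C (S p).
  move=> /CN [sN BN NA]; split; first exact: addset_submodule.
    by move=> x Cx; exists 0; [exact: submodule0 | exists x; rewrite ?add0r].
  by move=> _ [x Nx [y Cy <-]]; apply: submoduleD => //; [exact: NA | exact: CA].
suff H p : (p <= k)%N -> exists i j, [/\ (i + j)%N = p,
    chain_to (between C B) i (I p) & chain_to (between A C) j (S p)].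
  have [i [j [eq ci cj]]] := H k (leqnn k).
  by exists i, j; split=> //; apply: chain_to_has; eassumption.
elim: p => [|p IH] lep.
  by exists 0%N, 0%N; split=> //; apply: chain_to0; [exact: CI | exact: CS].
have [i [j [eq ci cj]]] := IH (ltnW lep).
have [leN nleN] := ltN p lep.
have leI : I p `<=` I p.+1 by move=> x [/leN ? ?].
have leS : S p `<=` S p.+1 by move=> _ [x /leN ? [y ? <-]]; exists x => //; exists y.
have [IE|nI] := pselect (I p.+1 `<=` I p); last first.
  exists i.+1, j; split; first by rewrite addSn eq.
    by apply: chain_toS ci _ _ => //; exact: CI.
  have [SE|nS] := pselect (S p.+1 `<=` S p).
    by have <- : S p = S p.+1 by apply/seteqP.
  have cj' : chain_to (between A C) j.+1 (S p.+1).
    by apply: chain_toS cj _ _ => //; exact: CS.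
  (* Both chains grow here, so the second one gives up its lowest member to keep
     the total length equal to [p.+1]. *)
  case: cj' => N' [CN' ltN' top']; exists (fun q => N' q.+1); split=> // q leq.
    by apply: CN'; rewrite ltnS.
  exact: ltN'.
exists i, j.+1; have <- : I p = I p.+1 by apply/seteqP.
split; rewrite ?addnS ?eq //.
apply: chain_toS cj (CS _ lep) _; split=> // SE; apply: nleN => x Nx.
have [sN _ _] := CN p (ltnW lep); have [sN1 _ _] := CN p.+1 lep.
have [|y Ny [z Cz xyz]] := SE x.
  by exists x => //; exists 0; [exact: submodule0 | rewrite addr0].
have [Nz _] : I p z.
  apply: IE; split=> //; rewrite -[z](addKr y) xyz.
  by apply: submoduleD => //; apply: submoduleN => //; exact: leN.
by rewrite -xyz; exact: submoduleD.
Qed.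

Lemma length_le_add (M : lmodType R) (A B C : set M) p q :
  submodule C -> B `<=` C -> C `<=` A -> submodule A ->
  length_le C B p -> length_le A C q -> length_le A B (p + q).
Proof.
move=> sC BC CA sA hp hq /(has_chain_split sC BC CA sA) [i [j [eq ci cj]]].
have [lti|lei] := ltnP p i; first by apply: hp; exact: has_chainW ci.
apply: hq; apply: has_chainW cj; lia.
Qed.

Section Image.
Variables (M N : lmodType R).

Definition linear_map (f : M -> N) : Prop :=
  forall a x y, f (a *: x + y) = a *: f x + f y.

Lemma linear_map0 f : linear_map f -> f 0 = 0.
Proof. by move=> lf; have := lf (-1) 0 0; rewrite !scaleN1r oppr0 addr0 addNr. Qed.

Lemma linear_mapD f x y : linear_map f -> f (x + y) = f x + f y.
Proof. by move=> lf; have := lf 1 x y; rewrite !scale1r. Qed.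

Lemma linear_mapZ f a x : linear_map f -> f (a *: x) = a *: f x.
Proof. by move=> lf; have := lf a x 0; rewrite linear_map0 // !addr0. Qed.

(** Chains of the target pull back to chains of the source. *)
Lemma length_le_image f (A B : set M) (A' B' : set N) n :
  linear_map f -> submodule A -> B `<=` A -> f @` B `<=` B' ->
  A' `<=` [set f a + b | a in A & b in B'] ->
  length_le A B n -> length_le A' B' n.
Proof.
move=> lf sA BA fB A'E hn [C [CC ltC]]; apply: hn.
exists (fun i => [set x | A x /\ C i (f x)]); split=> i lei.
  have [sCi B'Ci CiA'] := CC i lei; split.
  - split; first by split; [exact: submodule0|rewrite linear_map0 //; exact: submodule0].
      by move=> x y [? ?] [? ?]; rewrite /= linear_mapD //; split; exact: submoduleD.
    by move=> a x [? ?]; rewrite /= linear_mapZ //; split; exact: submoduleZ.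
  - by move=> x Bx; split; [exact: BA | apply: B'Ci; apply: fB; exists x].
  - by move=> x [].
have [le nle] := ltC i lei; split=> [x [Ax /le ?] //|nle'].
apply: nle => x Cx; have [sCi B'Ci _] := CC i (ltnW lei).
have [sCi1 B'Ci1 CiA'] := CC i.+1 lei.
have [a Aa [b Bb xE]] := A'E _ (CiA' _ Cx).
have [|_ Ca] := nle' a; last by rewrite -xE; apply: submoduleD => //; exact: B'Ci.
split=> //; rewrite -[f a](addrK b) xE; apply: submoduleB => //; exact: B'Ci1.
Qed.

(** Adding the images of the maps one at a time filters [A'/B'], and each layer
    is an image of [A/B]. *)
Lemma length_le_cover (fs : seq (M -> N)) (A B : set M) (A' B' : set N) n :
  submodule A -> B `<=` A -> submodule A' -> submodule B' -> B' `<=` A' ->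
  (forall k, (k < size fs)%N -> let f := nth (fun=> 0) fs k in
    [/\ linear_map f, f @` A `<=` A' & f @` B `<=` B']) ->
  A' `<=` foldl (fun U f => [set f a + u | a in A & u in U]) B' fs ->
  length_le A B n -> length_le A' B' (size fs * n).
Proof.
move=> sA BA sA' sB' B'A' Hfs cov hn.
elim: fs B' sB' B'A' Hfs cov => [|f fs IH] B' sB' B'A' Hfs /= cov.
  by rewrite mul0n; exact: length_le0.
have [lf fA fB] := Hfs 0%N isT.
pose C := [set f a + u | a in A & u in B'].
have sC : submodule C.
  have -> : C = [set x + y | x in f @` A & y in B'].
    apply/seteqP; split=> [_ [a Aa [b Bb <-]]|_ [_ [a Aa <-] [b Bb <-]]].
      by exists (f a); [exists a | exists b].
    by exists a => //; exists b.
  apply: addset_submodule => //; split.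
  - by exists 0; [exact: submodule0 | exact: linear_map0].
  - move=> _ _ [x Ax <-] [y Ay <-]; exists (x + y); first exact: submoduleD.
    exact: linear_mapD.
  - move=> c _ [x Ax <-]; exists (c *: x); first exact: submoduleZ.
    exact: linear_mapZ.
have B'C : B' `<=` C.
  by move=> b Bb; exists 0; [exact: submodule0|exists b; rewrite ?linear_map0 ?add0r].
have CA' : C `<=` A'.
  move=> _ [a Aa [b Bb <-]]; apply: submoduleD => //; last exact: B'A'.
  by apply: fA; exists a.
rewrite mulSn; apply: (length_le_add sC) => //.
  exact: length_le_image lf _ _ fB _ hn.
apply: IH => // k ltk; have [lg gA gB] := Hfs k.+1 ltk.
by split=> // x /gB; exact: B'C.
Qed.

End Image.

End Length.

(** * Ideals and their powers *)

Section IdealTheory.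
Local Open Scope classical_set_scope.
Variable R : comNzRingType.
Implicit Types (J K : set R).

Lemma ideal0 J : ideal J -> J 0.
Proof. exact: submodule0. Qed.

Lemma idealD J x y : ideal J -> J x -> J y -> J (x + y).
Proof. exact: submoduleD. Qed.

Lemma idealN J x : ideal J -> J x -> J (- x).
Proof. exact: submoduleN. Qed.

Lemma idealB J x y : ideal J -> J x -> J y -> J (x - y).
Proof. exact: submoduleB. Qed.

Lemma ideal_sum J (I : Type) (r : seq I) (P : pred I) (F : I -> R) :
  ideal J -> (forall i, P i -> J (F i)) -> J (\sum_(i <- r | P i) F i).
Proof. exact: submodule_sum. Qed.

Lemma idealM J a x : ideal J -> J x -> J (a * x).
Proof. by move=> iJ Jx; exact: (submoduleZ a iJ Jx). Qed.

Lemma idealMr J a x : ideal J -> J x -> J (x * a).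
Proof. by rewrite mulrC; exact: idealM. Qed.

Lemma ideal_setT : ideal (setT : set R).
Proof. by []. Qed.

Lemma ideal_full J : ideal J -> J 1 -> J = setT.
Proof.
by move=> iJ J1; apply/seteqP; split=> // x _; rewrite -[x]mulr1; exact: idealM.
Qed.

Lemma ideal_mul_ideal J K : ideal (ideal_mul J K).
Proof. exact: ideal_gen_ideal. Qed.

Lemma mem_ideal_mul J K x y : J x -> K y -> ideal_mul J K (x * y).
Proof. by move=> Jx Ky; apply: sub_ideal_gen; exists x => //; exists y. Qed.

Lemma ideal_mul_min J K (N : set R) : ideal N ->
  (forall x y, J x -> K y -> N (x * y)) -> ideal_mul J K `<=` N.
Proof.
by move=> iN H; apply: ideal_gen_min => // _ [x Jx [y Ky <-]]; exact: H.
Qed.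

Lemma ideal_mulS J J' K K' :
  J `<=` J' -> K `<=` K' -> ideal_mul J K `<=` ideal_mul J' K'.
Proof.
move=> JJ' KK'; apply: ideal_mul_min; first exact: ideal_mul_ideal.
by move=> x y /JJ' ? /KK' ?; exact: mem_ideal_mul.
Qed.

Lemma ideal_mul_subr J K : ideal K -> ideal_mul J K `<=` K.
Proof. by move=> iK; apply: ideal_mul_min => // x y _; exact: idealM. Qed.

Lemma ideal_mul_subl J K : ideal J -> ideal_mul J K `<=` J.
Proof. by move=> iJ; apply: ideal_mul_min => // x y Jx _; exact: idealMr. Qed.

Lemma ideal_mulTl K : ideal K -> ideal_mul setT K = K.
Proof.
move=> iK; apply/seteqP; split; first exact: ideal_mul_subr.
by move=> x Kx; rewrite -[x]mul1r; exact: mem_ideal_mul.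
Qed.

Lemma ideal_expSS J n : ideal_exp J n.+1 `<=` ideal_exp J n.
Proof. by apply: ideal_mul_subr; exact: ideal_exp_ideal. Qed.

Lemma ideal_exp_dec J k n : (k <= n)%N -> ideal_exp J n `<=` ideal_exp J k.
Proof.
elim: n => [|n IH]; first by rewrite leqn0 => /eqP ->.
rewrite leq_eqVlt => /orP[/eqP -> //|]; rewrite ltnS => /IH le.
by apply: subset_trans le; exact: ideal_expSS.
Qed.

Lemma ideal_expS J K n : J `<=` K -> ideal_exp J n `<=` ideal_exp K n.
Proof. by move=> JK; elim: n => [|n IH] //; exact: ideal_mulS. Qed.

Lemma ideal_expX J x n k : J x -> ideal_exp J k ((x ^+ n) : R) \/ (n < k)%N.
Proof.
move=> Jx; case: (ltnP n k) => [|le]; first by right.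
left; apply: (ideal_exp_dec le); elim: n {le} => [|n IH] //.
by rewrite exprS; exact: mem_ideal_mul.
Qed.

Lemma ideal_exp_prod J (I : finType) (F : I -> R) (e : I -> nat) :
  (forall i, J (F i) \/ e i = 0%N) ->
  ideal_exp J (\sum_i e i) (\prod_i F i ^+ e i).
Proof.
move=> JF; apply: (big_ind2 (fun k x => ideal_exp J k x)) => //.
  by move=> k x l y; exact: ideal_exp_mul.
move=> i _; case: (JF i) => [/(ideal_expX (e i) (e i))[//|]|->] //.
by rewrite ltnn.
Qed.

(** Zorn's lemma, applied to a family that also has the empty set as a member, so
    that the empty chain has an upper bound. *)
Lemma maximal_ideal_exists J : ideal J -> ~ J 1 ->
  exists P, maximal_ideal P /\ J `<=` P.
Proof.
move=> iJ J1.
pose G := [set X : set R | X = set0 \/ [/\ ideal X, ~ X 1 & J `<=` X]].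
have [F FG totF|P [[P0|[iP P1 JP]] maxP]] := @Zorn_bigcup _ G.
- have [[X0 [FX0 X0ne]]|Fall0] := pselect (exists X, F X /\ X <> set0); last first.
    left; apply/seteqP; split=> // x [X FX Xx]; apply: Fall0; exists X; split=> //.
    by move=> XE; rewrite XE in Xx.
  have FI X x : F X -> X x -> [/\ ideal X, ~ X 1 & J `<=` X].
    by move=> FX Xx; case: (FG X FX) => // XE; rewrite XE in Xx.
  have [iX0 _ JX0] : [/\ ideal X0, ~ X0 1 & J `<=` X0] by case: (FG _ FX0).
  right; split.
  + split.
    * by exists X0 => //; exact: ideal0.
    * move=> x y [X FX Xx] [Y FY Yy].
      have [iX _ _] := FI _ _ FX Xx; have [iY _ _] := FI _ _ FY Yy.
      case: (totF X Y FX FY) => le.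
        by exists Y => //; apply: idealD => //; exact: le.
      by exists X => //; apply: idealD => //; exact: le.
    * move=> a x [X FX Xx]; have [iX _ _] := FI _ _ FX Xx.
      by exists X => //; exact: idealM.
  + by move=> [X FX X1]; have [_ nX1 _] := FI _ _ FX X1.
  + by move=> x Jx; exists X0 => //; exact: JX0.
- exfalso; apply: (maxP J); last by right; split.
  by rewrite P0; split=> // /(_ 0); apply; exact: ideal0.
- exists P; split=> //; split=> // K iK K1 PK; apply/seteqP; split=> // x Kx.
  apply: contrapT => nPx; apply: (maxP K).
    by split=> // /(_ x Kx).
  by right; split=> // y /JP /PK.
Qed.

Lemma ideal_full_of_maximal J : ideal J ->
  (forall P, maximal_ideal P -> exists2 s, J s & ~ P s) -> J 1.
Proof.
move=> iJ H; apply: contrapT => J1.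
have [P [mP JP]] := maximal_ideal_exists iJ J1.
by have [s /JP] := H P mP.
Qed.

Lemma principal_ideal (x : R) : ideal [set y : R | exists c, y = c * x].
Proof.
split; first by exists 0; rewrite mul0r.
- by move=> _ _ [c ->] [c' ->]; exists (c + c'); rewrite mulrDl.
- by move=> a _ [c ->]; exists (a * c); rewrite -mulrA.
Qed.

Lemma unit_of_maximal (x : R) : (forall P : set R, maximal_ideal P -> ~ P x) ->
  exists y, y * x = 1.
Proof.
move=> H; have [c cE] : [set y | exists c, y = c * x] 1.
  apply: (ideal_full_of_maximal (principal_ideal x)) => P mP.
  by exists x; [exists 1; rewrite mul1r | exact: H].
by exists c.
Qed.

Lemma maximal_comaximal (P : set R) (x : R) : maximal_ideal P -> ~ P x ->
  exists y, P (1 - y * x).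
Proof.
move=> [iP P1 maxP] nPx.
pose K := [set u + v | u in P & v in [set y : R | exists c, y = c * x]].
have iK : ideal K := addset_submodule (M := R^o) iP (principal_ideal x).
have [K1|nK1] := pselect (K 1).
  by case: K1 => u Pu [_ [c ->] <-]; exists c; rewrite addrK.
case: nPx; rewrite -(maxP K iK nK1).
  by exists 0; [exact: ideal0 | exists x; rewrite ?add0r //; exists 1; rewrite mul1r].
by move=> u Pu; exists u => //; exists 0; [exists 0; rewrite mul0r | rewrite addr0].
Qed.

Lemma maximal_ideal_prime (P : set R) : maximal_ideal P -> prime_ideal P.
Proof.
move=> mP; have [iP P1 _] := mP; split=> // x y Pxy.
have [Px|/(maximal_comaximal mP)[c Pc]] := pselect (P x); [by left | right].
rewrite -[y]mul1r -(subrK (c * x) 1) mulrDl -mulrA.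
by apply: idealD => //; [exact: idealMr | exact: idealM].
Qed.

Lemma prime_idealX (P : set R) (x : R) n : prime_ideal P -> P (x ^+ n) -> P x.
Proof.
move=> [iP P1 pP]; elim: n => [|n IH]; first by rewrite expr0.
by rewrite exprS => /pP[].
Qed.

Lemma local_unit (m : set R) (x : R) : local_ring m -> ~ m x -> exists y, y * x = 1.
Proof. by move=> [_ um] nmx; apply: unit_of_maximal => P /um ->. Qed.

Lemma ideal_genE (s : seq R) (x : R) : ideal_gen [set` s] x ->
  exists c : 'I_(size s) -> R, x = \sum_i c i * s`_i.
Proof. exact: (@span_seqP R R^o). Qed.

End IdealTheory.

(** * Homogeneous forms and powers of a finitely generated ideal *)

Section Forms.
Local Open Scope classical_set_scope.
Variables (B : comNzRingType) (d : nat).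
Implicit Types (J : set B) (g h : {mpoly B[d]}).

Definition free_below (j : nat) (b : 'X_{1..d}) : bool :=
  [forall i : 'I_d, (i < j)%N ==> (b i == 0%N)].

Lemma free_belowP j (b : 'X_{1..d}) :
  reflect (forall i : 'I_d, (i < j)%N -> b i = 0%N) (free_below j b).
Proof.
apply: (iffP forallP) => H i; first by move/implyP: (H i) => K /K /eqP.
by apply/implyP => /H ->.
Qed.

Lemma free_below0 b : free_below 0 b.
Proof. exact/free_belowP. Qed.

Lemma free_belowD j b b' :
  free_below j (b + b')%MM = free_below j b && free_below j b'.
Proof.
apply/free_belowP/andP => [H|[/free_belowP H /free_belowP H'] i lt].
  by split; apply/free_belowP => i /H /eqP;
    rewrite mnmDE addn_eq0 => /andP[/eqP ? /eqP ?].
by rewrite mnmDE H // H'.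
Qed.

(** The restriction to the variables of index at least [j] lets an induction remove
    the variables one by one inside a fixed polynomial ring. *)
Definition form (j k : nat) J g : Prop := forall b,
  J g@_b /\ (g@_b != 0 -> (mdeg b == k) && free_below j b).

Lemma form_coef j k J g b : form j k J g -> J g@_b.
Proof. by move/(_ b) => []. Qed.

Lemma form_coef0 j k J g b :
  form j k J g -> ~~ ((mdeg b == k) && free_below j b) -> g@_b = 0.
Proof. by move/(_ b) => [_ H] nb; apply/eqP; apply: contraNT nb. Qed.

Lemma formW j k J J' g : J `<=` J' -> form j k J g -> form j k J' g.
Proof. by move=> JJ' fg b; have [/JJ' ? ?] := fg b. Qed.

Lemma formJ j k J J' g : form j k J g -> (forall b, J' g@_b) -> form j k J' g.
Proof. by move=> fg J'g b; have [_ ?] := fg b. Qed.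

Lemma form0 j k J : ideal J -> form j k J 0.
Proof. by move=> iJ b; rewrite mcoeff0 eqxx; split=> //; exact: ideal0. Qed.

Lemma formD j k J g h :
  ideal J -> form j k J g -> form j k J h -> form j k J (g + h).
Proof.
move=> iJ fg fh b; split; rewrite mcoeffD.
  by apply: idealD => //; [exact: form_coef fg | exact: form_coef fh].
apply: contraR => nb; rewrite (form_coef0 fg nb) (form_coef0 fh nb) addr0 //.
Qed.

Lemma formZ j k J c g : ideal J -> form j k J g -> form j k J (c *: g).
Proof.
move=> iJ fg b; split; rewrite mcoeffZ; first by apply: idealM => //; exact: form_coef fg.
by apply: contraR => nb; rewrite (form_coef0 fg nb) mulr0.
Qed.

Lemma formB j k J g h :
  ideal J -> form j k J g -> form j k J h -> form j k J (g - h).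
Proof. by move=> iJ fg fh; apply: formD => //; rewrite -scaleN1r; exact: formZ. Qed.

Lemma formM j k l J g h :
  ideal J -> form j k J g -> form j l setT h -> form j (k + l) J (g * h).
Proof.
move=> iJ fg fh b; rewrite mcoeffM; split.
  by apply: ideal_sum => // p _; apply: idealMr => //; exact: form_coef fg.
apply: contraR => nb; rewrite big1 //= => -[b1 b2] /= /eqP bE.
have [n1|/negPn /andP[/eqP e1 f1]] := boolP (~~ ((mdeg b1 == k) && free_below j b1)).
  by rewrite (form_coef0 fg n1) mul0r.
have [n2|/negPn /andP[/eqP e2 f2]] := boolP (~~ ((mdeg b2 == l) && free_below j b2)).
  by rewrite (form_coef0 fh n2) mulr0.
by case/negP: nb; rewrite bE mdegD e1 e2 eqxx free_belowD f1 f2.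
Qed.

Lemma formX j b : free_below j b -> form j (mdeg b) setT 'X_[b].
Proof. by move=> fb b'; split=> //; rewrite mcoeffX; have [<- _|_] := eqVneq b b'; rewrite eqxx. Qed.

Lemma formC j J c : J c -> J 0 -> form j 0 J c%:MP.
Proof.
move=> Jc J0 b; rewrite mcoeffC; have [->|nb] := eqVneq b 0%MM.
  rewrite mulr1 mdeg0; split=> //= _.
  by apply/free_belowP => i _; rewrite mnm0E.
by rewrite mulr0 eqxx.
Qed.

Variable a : d.-tuple B.

Lemma mem_drop_tnth j (i : 'I_d) : (j <= i)%N -> tnth a i \in drop j a.
Proof.
move=> le; rewrite (tnth_nth 0) -(subnKC le) -nth_drop mem_nth //.
by rewrite size_drop size_tuple ltn_sub2r //; exact: leq_ltn_trans (ltn_ord i).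
Qed.

Lemma ideal_exp_mmap1 j k b : mdeg b = k -> free_below j b ->
  ideal_exp (ideal_gen [set` drop j a]) k (mmap1 (tnth a) b).
Proof.
move=> <- /free_belowP fb; rewrite mdegE; apply: ideal_exp_prod => i.
case: (ltnP i j) => [/fb|le]; first by right.
by left; apply: sub_ideal_gen => /=; exact: mem_drop_tnth.
Qed.

Lemma form_exp j k J g : form j k J g ->
  ideal_mul J (ideal_exp (ideal_gen [set` drop j a]) k) g.@[tnth a].
Proof.
move=> fg; apply: ideal_sum; first exact: ideal_mul_ideal.
move=> b _; have [nb|nb] := eqVneq g@_b 0.
  by rewrite nb mul0r; apply: ideal0; exact: ideal_mul_ideal.
apply: mem_ideal_mul; first exact: form_coef fg.
by have [_ /(_ nb) /andP[/eqP e f]] := fg b; exact: ideal_exp_mmap1.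
Qed.

(** Membership in a product [J Q^k] thus becomes a question on the coefficients
    of a form: monomials in the generators span [Q^k], and the factor from [J] is
    absorbed by their coefficients. *)
Lemma ideal_mul_expE j k J : ideal J ->
  ideal_mul J (ideal_exp (ideal_gen [set` drop j a]) k) =
  [set g.@[tnth a] | g in form j k J].
Proof.
move=> iJ; apply/seteqP; split; last by move=> _ [g fg <-]; exact: form_exp.
have iF l : ideal [set g.@[tnth a] | g in form j l setT].
  split; first by exists 0; [exact: form0 | rewrite raddf0].
  - move=> _ _ [g fg <-] [h fh <-]; exists (g + h); last by rewrite raddfD.
    exact: formD.
  - by move=> c _ [g fg <-]; exists (c *: g); [exact: formZ | rewrite mevalZ].
have QF l : ideal_exp (ideal_gen [set` drop j a]) l `<=`
            [set g.@[tnth a] | g in form j l setT].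
  elim: l => [|l IH].
    by move=> x _; exists x%:MP; [exact: formC | rewrite mevalC].
  apply: ideal_mul_min => // x y Qx /IH [g fg <-].
  suff : [set x | [set g.@[tnth a] | g in form j l.+1 setT] (x * g.@[tnth a])] x by [].
  apply: (ideal_gen_min _ _ Qx).
    split; rewrite /=; first by rewrite mul0r; exact: ideal0 (iF _).
      by move=> u v Hu Hv; rewrite mulrDl; exact: idealD (iF _) Hu Hv.
    by move=> c u Hu; rewrite -[c *: u]/(c * u) -mulrA; exact: idealM (iF _) Hu.
  move=> u /= /nthP -/(_ 0) [i]; rewrite size_drop size_tuple nth_drop => lti <-.
  have ltji : (j + i < d)%N by lia.
  exists ('X_(Ordinal ltji) * g); last first.
    by rewrite rmorphM /= mevalXU (tnth_nth 0).
  rewrite -add1n -(mdeg1 (Ordinal ltji)); apply: formM => //; apply: formX.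
  by apply/free_belowP => i' lt; rewrite mnm1E -val_eqE /=; case: eqP => // E; lia.
apply: ideal_mul_min.
  split; first by exists 0; [exact: form0 | rewrite raddf0].
  - move=> _ _ [g fg <-] [h fh <-]; exists (g + h); last by rewrite raddfD.
    exact: formD.
  - by move=> c _ [g fg <-]; exists (c *: g); [exact: formZ | rewrite mevalZ].
move=> x _ Jx /QF [g fg <-]; exists (x *: g); last by rewrite mevalZ.
by move=> b; have [_] := formZ x (ideal_setT B) fg b; split=> //; rewrite mcoeffZ; exact: idealMr.
Qed.

Lemma ideal_exp_formE j k :
  ideal_exp (ideal_gen [set` drop j a]) k = [set g.@[tnth a] | g in form j k setT].
Proof. by rewrite -ideal_mul_expE // ideal_mulTl //; exact: ideal_exp_ideal. Qed.

End Forms.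

Section NoetherianPowers.
Local Open Scope classical_set_scope.
Variable R : comNzRingType.
Hypothesis noethR : noetherian R.

(** By the pigeonhole principle, a monomial of large degree in finitely many
    elements contains a large power of one of them. *)
Lemma radical_exp (J K : set R) : ideal J -> ideal K -> J `<=` radical K ->
  exists t, ideal_exp J t `<=` K.
Proof.
move=> iJ iK JK; have [s sE] := noethR iJ.
have [N HN] : exists N, forall i : 'I_(size s), K (tnth (in_tuple s) i ^+ N).
  have Hi i : exists n, K (tnth (in_tuple s) i ^+ n).
    by apply: JK; rewrite sE; apply: sub_ideal_gen => /=; exact: mem_tnth.
  pose f i := projT1 (cid (Hi i)); exists (\max_i f i) => i.
  have := projT2 (cid (Hi i)); rewrite -/(f i) => Ki.
  by rewrite -(subnK (leq_bigmax i)) exprD; exact: idealM.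
exists ((size s * N).+1); rewrite sE.
have := ideal_exp_formE (in_tuple s) 0 (size s * N).+1; rewrite drop0 => -> _ [g fg <-].
apply: ideal_sum => // b _; have [->|nb] := eqVneq g@_b 0.
  by rewrite mul0r; exact: ideal0.
have [_ /(_ nb) /andP[/eqP bdeg _]] := fg b; apply: idealM => //.
have [i lei] : exists i, (N <= b i)%N.
  apply: contrapT => nex; move: bdeg; rewrite mdegE => bdeg.
  have : (\sum_i b i <= \sum_(i < size s) N)%N.
    by apply: leq_sum => i _; rewrite leqNgt; apply/negP => lt; apply: nex; exists i; exact: ltnW.
  by rewrite bdeg sum_nat_const card_ord ltnn.
rewrite /mmap1 (bigD1 i) //=; apply: idealMr => //.
by rewrite -(subnK lei) exprD; exact: idealM.
Qed.

End NoetherianPowers.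

(** * Generators and finite length over a local ring *)

Section Generators.
Local Open Scope classical_set_scope.
Variables (R : comNzRingType) (N : lmodType R).

Lemma cover_sum (M : lmodType R) (fs : seq (M -> N)) (A : set M) (B : set N)
    (c : nat -> M) b :
  (forall k, (k < size fs)%N -> A (c k)) -> B b ->
  foldl (fun U f => [set f a + u | a in A & u in U]) B fs
    (\sum_(k < size fs) nth (fun=> 0) fs k (c k) + b).
Proof.
elim: fs B b c => [|f fs IH] B b c /= Ac Bb; first by rewrite big_ord0 add0r.
rewrite big_ord_recl /= addrAC addrC.
apply: (IH _ _ (fun k => c k.+1)); first by move=> k lt; exact: Ac.
by exists (c 0%N); [exact: Ac | exists b].
Qed.

(** A module with [q] generators, each killed by [J], is covered by [q] copies
    of [R/J]. *)
Lemma length_le_gen (s : seq N) (J : set R) (A B : set N) n :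
  ideal J -> submodule A -> submodule B -> B `<=` A -> [set` s] `<=` A ->
  (forall x a, x \in s -> J a -> B (a *: x)) ->
  A `<=` [set x + y | x in span [set` s] & y in B] ->
  length_le (setT : set R^o) (J : set R^o) n -> length_le A B (size s * n).
Proof.
move=> iJ sA sB BA sinA JB cov hn.
pose fs := [seq (fun a : R^o => a *: x) | x <- s].
rewrite -[size s](size_map (fun x (a : R^o) => a *: x)) -/fs.
have fsE k : (k < size s)%N -> nth (fun=> 0) fs k = fun a : R^o => a *: s`_k.
  by move=> lt; rewrite (nth_map 0).
apply: length_le_cover hn => //.
- move=> k; rewrite size_map => lt; rewrite /= fsE //; split.
  + by move=> a x y; rewrite scalerDl scalerA.
  + by move=> _ [a _ <-]; apply: submoduleZ => //; apply: sinA; exact: mem_nth.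
  + by move=> _ [a Ja <-]; apply: JB => //; exact: mem_nth.
- move=> x /cov [y /span_seqP [c ->] [b Bb <-]].
  pose c' k : R^o := if insub k is Some i then c i else 0.
  have -> : \sum_i c i *: s`_i = \sum_(k < size fs) nth (fun=> 0) fs k (c' k).
    rewrite size_map; apply: eq_bigr => i _.
    by rewrite fsE //= /c' valK.
  exact: cover_sum.
Qed.

End Generators.

Section LocalRing.
Local Open Scope classical_set_scope.
Variables (R : comNzRingType) (m : set R).
Hypothesis localm : local_ring m.

Lemma local_prime : prime_ideal m.
Proof. by apply: maximal_ideal_prime; case: localm. Qed.

Lemma local_ideal : ideal m.
Proof. by case: local_prime. Qed.

Lemma residue_length : length_le (setT : set R^o) (m : set R^o) 1.
Proof.
have [[_ _ maxm] _] := localm; move=> [N [CN ltN]].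
have [_ mN0 _] := CN 0%N isT; have [iN1 mN1 _] := CN 1%N isT.
have [_ nle0] := ltN 0%N isT; have [_ nle1] := ltN 1%N isT.
have [N1|nN1] := pselect (N 1%N 1).
  by apply: nle1; rewrite (ideal_full iN1 N1).
by apply: nle0; rewrite (maxm _ iN1 nN1 mN1).
Qed.

Hypothesis noethR : noetherian R.

(** Each layer [m^i / m^(i+1)] is finitely generated and killed by [m]. *)
Lemma power_length t : exists n,
  length_le (setT : set R^o) (ideal_exp m t : set R^o) n.
Proof.
elim: t => [|t [n hn]]; first by exists 0%N; exact: length_le0.
have [s sE] := noethR (ideal_exp_ideal m t).
exists (size s * 1 + n)%N.
apply: (length_le_add (C := ideal_exp m t : set R^o)) => //.
- exact: ideal_exp_ideal.
- exact: ideal_expSS.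
apply: (@length_le_gen R R^o s m (ideal_exp m t) (ideal_exp m t.+1) 1) => //.
- exact: local_ideal.
- exact: ideal_exp_ideal.
- exact: ideal_exp_ideal.
- exact: ideal_expSS.
- by rewrite sE; exact: sub_ideal_gen.
- move=> x a xs ma; have mx : ideal_exp m t x by rewrite sE; exact: sub_ideal_gen.
  exact: mem_ideal_mul ma mx.
- move=> x mx; exists x; last by exists 0; rewrite ?addr0 //; apply: ideal0; exact: ideal_exp_ideal.
  by move: mx; rewrite sE.
- exact: residue_length.
Qed.

(** Gaussian elimination over the residue field, carried out on representatives:
    an entry outside [m] is a unit of [R] and serves as a pivot. *)
Lemma local_dependence (T U : finType) (M : T -> U -> R) (A : {set T}) (B : {set U}) :
  (#|B| < #|A|)%N -> exists c : T -> R,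
    (exists2 i, i \in A & ~ m (c i)) /\
    (forall j, j \in B -> m (\sum_(i in A) c i * M i j)).
Proof.
have [im m1 _] := local_prime.
elim: {B}#|B| {-2}B (erefl #|B|) A M => [|k IH] B cB A M ltA.
  have /card_gt0P[i iA] : (0 < #|A|)%N by rewrite -cB.
  exists (fun=> 1); split; first by exists i.
  by move=> j; rewrite (cards0_eq cB) inE.
have /card_gt0P[j0 jB] : (0 < #|B|)%N by rewrite cB.
have cB' : #|B :\ j0| = k by move: cB; rewrite (cardsD1 j0) jB => -[].
have [all0|[i0 i0A nm]] : (forall i, i \in A -> m (M i j0)) \/
    (exists2 i, i \in A & ~ m (M i j0)).
  have [?|H] := pselect (exists2 i, i \in A & ~ m (M i j0)); first by right.
  by left=> i iA; apply: contrapT => nm; apply: H; exists i.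
  have [|c [c1 c2]] := IH _ cB' A M; first by rewrite cB'; apply: ltn_trans ltA; rewrite cB.
  exists c; split=> // j jB'; have [->|ne] := eqVneq j j0.
    by apply: ideal_sum => // i iA; apply: idealM => //; exact: all0.
  by apply: c2; rewrite !inE ne.
have [u uE] := local_unit localm nm.
pose M' i j := M i j - M i j0 * u * M i0 j.
have [|c [[i1 i1A c1] c2]] := IH _ cB' (A :\ i0) M'.
  by move: ltA; rewrite cB' cB (cardsD1 i0 A) i0A.
pose e := - \sum_(i in A :\ i0) c i * M i j0 * u.
exists (fun i => if i == i0 then e else c i); split.
  by move: i1A; rewrite !inE => /andP[ne ?]; exists i1 => //; rewrite (negPf ne).
move=> j jB'; rewrite (bigD1 i0) //= eqxx.
have -> : \sum_(i in A | i != i0) (if i == i0 then e else c i) * M i j =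
          \sum_(i in A :\ i0) c i * M i j.
  apply: eq_big => [i|i /andP[_ /negPf -> //]]; by rewrite !inE andbC.
have -> : e * M i0 j + \sum_(i in A :\ i0) c i * M i j =
          \sum_(i in A :\ i0) c i * M' i j.
  rewrite mulNr mulr_suml addrC -sumrB; apply: eq_bigr => i _.
  by rewrite /M'; ring.
have [->|ne] := eqVneq j j0; last by apply: c2; rewrite !inE ne.
rewrite big1 => [|i _]; first exact: ideal0.
by rewrite /M' -[_ * u * _]mulrA uE mulr1 subrr mulr0.
Qed.

End LocalRing.

(** * Leading coefficients *)

Section Leading.
Local Open Scope classical_set_scope.

Lemma seq_max disp (T : orderType disp) (s : seq T) (P : T -> Prop) :
  (exists2 x, x \in s & P x) ->
  exists x, [/\ x \in s, P x & forall y, y \in s -> P y -> (y <= x)%O].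
Proof.
elim: s => [[x]//|z s IH] [x xs Px].
have [/IH [y [ys Py maxy]]|ns] := pselect (exists2 x, x \in s & P x); last first.
  move: xs; rewrite inE => /predU1P[xz|xs]; last by case: ns; exists x.
  exists z; rewrite inE eqxx -xz; split=> // y; rewrite inE => /predU1P[->//|ys Py].
  by case: ns; exists y.
have [[Pz lt]|H] := pselect (P z /\ (y < z)%O).
  exists z; rewrite inE eqxx; split=> // w; rewrite inE => /predU1P[-> //|ws Pw].
  exact: le_trans (maxy w ws Pw) (ltW lt).
exists y; rewrite inE ys orbT; split=> // w; rewrite inE => /predU1P[-> Pz|]; last exact: maxy.
by rewrite leNgt; apply/negP => lt; apply: H.
Qed.

Variables (B : comNzRingType) (d : nat).
Implicit Types (f g : {mpoly B[d]}).

Lemma mpoly_max g (P : 'X_{1..d} -> Prop) :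
  (forall b, P b -> g@_b != 0) -> (exists b, P b) ->
  exists b, P b /\ forall b', P b' -> (b' <= b)%O.
Proof.
move=> Pg [b Pb]; have [|x [_ Px maxx]] := @seq_max _ _ (msupp g) P.
  by exists b => //; rewrite mcoeff_msupp; exact: Pg.
by exists x; split=> // b' Pb'; apply: maxx => //; rewrite mcoeff_msupp; exact: Pg.
Qed.

(** The monomial order is additive, so any other pair of monomials with product
    [b + c] has a first member above [b] or a second one above [c]. *)
Lemma mcoeffM_lead (J : set B) f g b c : ideal J ->
  (forall b' c', (b' + c' = b + c)%MM -> (b < b')%O -> J (f@_b' * g@_c')) ->
  (forall b' c', (b' + c' = b + c)%MM -> (c < c')%O -> J (f@_b' * g@_c')) ->
  J ((f * g)@_(b + c) - f@_b * g@_c).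
Proof.
move=> iJ Jf Jg; rewrite mcoeffM.
have lt1 (x y : 'X_{1..d}) : (x <= x + y)%MM by apply/mnm_lepP => i; rewrite mnmDE leq_addr.
have dlt (x : 'X_{1..d}) : (x <= b + c)%MM -> (mdeg x < (mdeg (b + c)).+1)%N.
  by move=> /mnm_lepP le; rewrite ltnS !mdegE; apply: leq_sum => i _; exact: le.
have Hb := dlt b (lt1 b c); have Hc : (mdeg c < (mdeg (b + c)%MM).+1)%N.
  by apply: dlt; rewrite addmC.
rewrite (bigD1 (BMultinom Hb, BMultinom Hc)) //= addrAC subrr add0r.
apply: ideal_sum => // -[b' c'] /= /andP[/eqP E ne].
have [ltb|leb] := ltP b (b' : 'X_{1..d}); first by apply: Jf => //; rewrite -E.
have [ltc|lec] := ltP c (c' : 'X_{1..d}); first by apply: Jg => //; rewrite -E.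
case/negP: ne; apply/eqP.
have := lec; rewrite -(lemc_add2r (b' : 'X_{1..d})) -E lemc_add2l => lbb.
have := leb; rewrite -(lemc_add2l _ _ (c' : 'X_{1..d})) -E lemc_add2r => lcc.
congr pair; apply/val_inj => /=; apply/eqP; rewrite eq_le.
  by rewrite leb.
by rewrite lec.
Qed.

End Leading.

(** * Nakayama's lemma and Noetherian modules *)

Section Nakayama.
Local Open Scope classical_set_scope.
Variables (R : comNzRingType) (J : set R).
Hypotheses (iJ : ideal J) (J_rad : forall c, J c -> exists u, u * (1 - c) = 1).

(** Solving for one generator at a time replaces the determinant trick. *)
Lemma nakayama (M : lmodType R) (s : seq M) (B : set M) : submodule B ->
  (forall x, x \in s -> exists c : nat -> R, (forall i, J (c i)) /\
     B (x - \sum_(i < size s) c i *: s`_i)) ->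
  forall x, x \in s -> B x.
Proof.
move=> sB; elim: s => [//|x0 s IH] H.
have [c [Jc Bc]] := H x0 (mem_head _ _).
move: Bc; rewrite big_ord_recl /= => Bc.
have [u uE] := J_rad (Jc 0%N).
have Bx0 : B (x0 - \sum_(i < size s) (u * c i.+1) *: s`_i).
  have -> : x0 - \sum_(i < size s) (u * c i.+1) *: s`_i =
      u *: (x0 - (c 0%N *: x0 + \sum_(i < size s) c (bump 0 i) *: s`_i)).
    rewrite opprD addrA -{2}[x0]scale1r -scalerBl scalerBr scalerA uE scale1r.
    by congr (_ - _); rewrite scaler_sumr; apply: eq_bigr => i _; rewrite scalerA.
  exact: submoduleZ.
have Bs x : x \in s -> B x.
  apply: IH => y ys; have ys' : y \in x0 :: s by rewrite inE ys orbT.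
  have [e [Je]] := H y ys'.
  rewrite big_ord_recl /= => Be.
  exists (fun i => e i.+1 + e 0%N * (u * c i.+1)); split.
    by move=> i; apply: idealD => //; exact: idealMr.
  have -> : y - \sum_(i < size s) (e i.+1 + e 0%N * (u * c i.+1)) *: s`_i =
      (y - (e 0%N *: x0 + \sum_(i < size s) e (bump 0 i) *: s`_i))
      + e 0%N *: (x0 - \sum_(i < size s) (u * c i.+1) *: s`_i).
    have -> : \sum_(i < size s) (e i.+1 + e 0%N * (u * c i.+1)) *: s`_i =
        \sum_(i < size s) e i.+1 *: s`_i
        + e 0%N *: \sum_(i < size s) (u * c i.+1) *: s`_i.
      rewrite scaler_sumr -big_split; apply: eq_bigr => i _ /=.
      by rewrite scalerDl scalerA.
    by rewrite scalerBr !opprD !addrA [X in _ = X + _]addrAC addrNK.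
  by apply: submoduleD => //; exact: submoduleZ.
move=> x; rewrite inE => /predU1P[->|/Bs //].
rewrite -[x0](subrK (\sum_(i < size s) (u * c i.+1) *: s`_i)).
apply: submoduleD => //; apply: submodule_sum => // i _; apply: submoduleZ => //.
by apply: Bs; exact: mem_nth.
Qed.

End Nakayama.

Section NoetherianModules.
Local Open Scope classical_set_scope.
Variable R : comNzRingType.

Definition noetherian_module (M : lmodType R) : Prop :=
  forall N : set M, submodule N -> exists s : seq M, N = span [set` s].

Lemma noetherian_regular : noetherian R -> noetherian_module (R^o : lmodType R).
Proof. by []. Qed.

(** A submodule of the product is generated by generators of its trace on the
    first factor and by lifts of generators of its image in the second. *)
Lemma noetherian_pair (M1 M2 : lmodType R) :
  noetherian_module M1 -> noetherian_module M2 ->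
  noetherian_module (M1 * M2)%type.
Proof.
move=> n1 n2 N sN.
have [s1 s1E] : exists s : seq M1, [set x : M1 | N (x, 0)] = span [set` s].
  apply: n1; split; first exact: submodule0 sN.
    move=> x y Nx Ny; have := submoduleD sN Nx Ny.
    by rewrite -[_ + _]/(x + y, 0 + 0) addr0.
  move=> a x Nx; have := submoduleZ a sN Nx.
  by rewrite -[_ *: _]/(a *: x, a *: 0) scaler0.
have [s2 s2E] : exists s : seq M2, [set y : M2 | exists x, N (x, y)] = span [set` s].
  apply: n2; split; first by exists 0; exact: submodule0 sN.
    move=> y y' [x Nx] [x' Nx']; exists (x + x'); by have := submoduleD sN Nx Nx'.
  move=> a y [x Nx]; exists (a *: x); by have := submoduleZ a sN Nx.
pose lift y : M1 := if pselect (exists x, N (x, y)) is left h then projT1 (cid h) else 0.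
have liftP y : y \in s2 -> N (lift y, y).
  move=> ys; rewrite /lift; case: pselect => [h|[]]; first exact: projT2 (cid h).
  suff : [set y | exists x, N (x, y)] y by [].
  by rewrite s2E; exact: sub_span.
pose s := [seq (x, 0) | x <- s1] ++ [seq (lift y, y) | y <- s2].
exists s; apply/seteqP; split; last first.
  apply: span_min => // z; rewrite /= mem_cat => /orP[/mapP[x xs ->]|/mapP[y ys ->]].
    suff : [set x | N (x, 0)] x by [].
    by rewrite s1E; exact: sub_span.
  exact: liftP.
have sS := span_submodule [set` s].
move=> [x y] Nxy.
have [x' Sx'] : exists x', span [set` s] (x', y).
  suff : span [set` s2] `<=` [set y | exists x', span [set` s] (x', y)].
    by apply; rewrite -s2E; exists x.
  apply: span_min.
    split; first by exists 0; exact: submodule0 sS.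
      move=> u v [u' Su] [v' Sv]; exists (u' + v'); by have := submoduleD sS Su Sv.
    move=> a u [u' Su]; exists (a *: u'); by have := submoduleZ a sS Su.
  move=> v vs; exists (lift v); apply: sub_span; rewrite /= mem_cat.
  by apply/orP; right; apply/mapP; exists v.
have SN : span [set` s] `<=` N.
  apply: span_min => // z; rewrite /= mem_cat => /orP[/mapP[u us ->]|/mapP[v vs ->]].
    suff : [set x | N (x, 0)] u by [].
    by rewrite s1E; exact: sub_span.
  exact: liftP.
have dE : (x, y) - (x', y) = (x - x', 0) by rewrite -[_ - _]/(x - x', y - y) subrr.
have Nd : [set x | N (x, 0)] (x - x').
  by rewrite /= -dE; apply: (submoduleB sN) => //; exact: SN.
rewrite -[(x, y)](subrK (x', y)) dE; apply: (submoduleD sS) => //.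
suff : span [set` s1] `<=` [set u | span [set` s] (u, 0)] by apply; rewrite -s1E.
apply: span_min; last first.
  move=> u us; apply: sub_span; rewrite /= mem_cat; apply/orP; left.
  by apply/mapP; exists u.
split; first exact: submodule0 sS.
  move=> u v Su Sv; have := submoduleD sS Su Sv.
  by rewrite -[_ + _]/(u + v, 0 + 0) addr0.
move=> a u Su; have := submoduleZ a sS Su.
by rewrite -[_ *: _]/(a *: u, a *: 0) scaler0.
Qed.

End NoetherianModules.

(** * The Koszul complex *)

Section Koszul.
Local Open Scope classical_set_scope.
Variable S : comNzRingType.
Implicit Types (l : seq S) (N P : set S).

(** The Koszul complex on [a :: l] is the mapping cone of multiplication by [a]
    on that of [l]: an element is a pair [u + e_a v]. *)
Fixpoint kos l : lmodType S :=
  if l is _ :: l' then ((kos l' * kos l')%type : lmodType S) else (S^o : lmodType S).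

Fixpoint kos_d l : kos l -> kos l :=
  match l return kos l -> kos l with
  | [::] => fun=> 0
  | a :: l' => fun u => (kos_d u.1 + a *: u.2, - kos_d u.2)
  end.

Fixpoint kos_deg l (i : nat) : kos l -> Prop :=
  match l return kos l -> Prop with
  | [::] => fun u => i = 0%N \/ u = 0
  | a :: l' => fun u => kos_deg i u.1 /\
      (if i is i'.+1 then kos_deg i' u.2 else u.2 = 0)
  end.

Fixpoint kos_in N l : kos l -> Prop :=
  match l return kos l -> Prop with
  | [::] => fun u => N u
  | a :: l' => fun u => kos_in N u.1 /\ kos_in N u.2
  end.

(** Exterior multiplication by the basis vector of the [k]-th entry. *)
Fixpoint kos_h l (k : nat) : kos l -> kos l :=
  match l return kos l -> kos l with
  | [::] => fun=> 0
  | a :: l' => fun u =>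
      if k is k'.+1 then (kos_h k' u.1, - kos_h k' u.2) else (0, u.1)
  end.

Fixpoint kos_0 l (c : S) : kos l :=
  match l return kos l with
  | [::] => c
  | a :: l' => (kos_0 l' c, 0)
  end.

Lemma pairE (M1 M2 : lmodType S) (u v : M1 * M2) a :
  a *: u + v = (a *: u.1 + v.1, a *: u.2 + v.2).
Proof. by []. Qed.

Lemma kos_d_lin l : linear_map (@kos_d l).
Proof.
elim: l => [|b l IH] a u v; first by rewrite /= scaler0 addr0.
rewrite /= pairE /= !IH; congr pair.
  by rewrite !scalerDr !scalerA addrACA [b * a]mulrC.
by rewrite opprD scalerN.
Qed.

Lemma kos_h_lin l k : linear_map (@kos_h l k).
Proof.
elim: l k => [|b l IH] k a u v; first by rewrite /= scaler0 addr0.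
case: k => [|k]; rewrite /= pairE; first by rewrite /= scaler0 addr0.
by rewrite /= !IH opprD scalerN.
Qed.

Lemma kos_d0 l : @kos_d l 0 = 0. Proof. exact: linear_map0 (@kos_d_lin l). Qed.
Lemma kos_dD l (u v : kos l) : kos_d (u + v) = kos_d u + kos_d v.
Proof. exact: linear_mapD (@kos_d_lin l). Qed.
Lemma kos_dZ l a (u : kos l) : kos_d (a *: u) = a *: kos_d u.
Proof. exact: linear_mapZ (@kos_d_lin l). Qed.
Lemma kos_dN l (u : kos l) : kos_d (- u) = - kos_d u.
Proof. by rewrite -scaleN1r kos_dZ scaleN1r. Qed.
Lemma kos_dB l (u v : kos l) : kos_d (u - v) = kos_d u - kos_d v.
Proof. by rewrite kos_dD kos_dN. Qed.
Lemma kos_h0 l k : @kos_h l k 0 = 0. Proof. exact: linear_map0 (@kos_h_lin l k). Qed.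
Lemma kos_hD l k (u v : kos l) : kos_h k (u + v) = kos_h k u + kos_h k v.
Proof. exact: linear_mapD (@kos_h_lin l k). Qed.
Lemma kos_hZ l k a (u : kos l) : kos_h k (a *: u) = a *: kos_h k u.
Proof. exact: linear_mapZ (@kos_h_lin l k). Qed.
Lemma kos_hN l k (u : kos l) : kos_h k (- u) = - kos_h k u.
Proof. by rewrite -scaleN1r kos_hZ scaleN1r. Qed.

Lemma kos_dd l (u : kos l) : kos_d (kos_d u) = 0.
Proof.
elim: l u => [|a l IH] u; first by [].
rewrite /= kos_dD kos_dZ kos_dN !IH scalerN add0r subrr !oppr0.
by [].
Qed.

(** This homotopy makes the ideal of the sequence act as zero on the homology. *)
Lemma kos_homotopy l k (u : kos l) : (k < size l)%N ->
  kos_d (kos_h k u) + kos_h k (kos_d u) = l`_k *: u.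
Proof.
elim: l k u => [|a l IH] k; first by move=> u; rewrite ltn0.
case: k => [|k] [u v] /=.
  move=> _; rewrite kos_d0 add0r -[(_, _) + (_, _)]/(a *: u + 0, - kos_d u + (kos_d u + a *: v)).
  by rewrite addr0 addKr.
rewrite ltnS => ltk.
rewrite -[(_, _) + (_, _)]/((kos_d (kos_h k u) + a *: - kos_h k v) + kos_h k (kos_d u + a *: v),
   - kos_d (- kos_h k v) + - kos_h k (- kos_d v)).
rewrite kos_dN kos_hN !opprK IH // kos_hD kos_hZ scalerN.
by rewrite [kos_h k _ + _]addrC addrA addrNK IH.
Qed.

Lemma kos_deg0 l i : @kos_deg l i 0.
Proof. by elim: l i => [|a l IH] i; [right | split => //; case: i]. Qed.

Lemma kos_deg_lin l i a (u v : kos l) :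
  kos_deg i u -> kos_deg i v -> kos_deg i (a *: u + v).
Proof.
elim: l i u v => [|b l IH] i u v /=.
  move=> [i0|u0] [j0|v0]; try by left.
  by right; rewrite u0 v0 scaler0 addr0.
case: i => [|i] [u1 u2] [v1 v2]; split; try exact: IH.
by rewrite /= u2 v2 scaler0 addr0.
Qed.

Lemma kos_deg_submodule l i : submodule (@kos_deg l i).
Proof.
split; first exact: kos_deg0.
  by move=> u v du dv; rewrite -[u]scale1r; exact: kos_deg_lin.
by move=> a u du; rewrite -[_ *: _]addr0; apply: kos_deg_lin => //; exact: kos_deg0.
Qed.

Lemma kos_deg_size l i (u : kos l) : (size l < i)%N -> kos_deg i u -> u = 0.
Proof.
elim: l i u => [|a l IH] i u.
  by case: i => [//|i] _ [].
case: i u => [//|i] [u v] lt [/= du dv].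
have -> : u = 0 by apply: IH du; exact: ltnW.
by have -> : v = 0 by apply: IH dv.
Qed.

Lemma kos_deg_d l i (u : kos l) : kos_deg i.+1 u -> kos_deg i (kos_d u).
Proof.
elim: l i u => [|a l IH] i u; first by right.
move=> [/= du dv]; split=> /=.
  by rewrite addrC; apply: kos_deg_lin => //; exact: IH.
case: i du dv => [|i] du dv.
  suff -> : kos_d u.2 = 0 by rewrite oppr0.
  by elim: l {IH u du} u.2 dv => [|b l IH] //= v [dv1 ->]; rewrite IH // kos_d0 scaler0 addr0 oppr0.
by apply: submoduleN; [exact: kos_deg_submodule | exact: IH].
Qed.

Lemma kos_deg_h l i k (u : kos l) : kos_deg i u -> kos_deg i.+1 (kos_h k u).
Proof.
elim: l i k u => [|a l IH] i k u; first by right.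
move=> [/= du dv]; case: k => [|k]; split=> //=; first exact: kos_deg0.
  exact: IH.
case: i du dv => [|i] du dv; last by apply: submoduleN; [exact: kos_deg_submodule | exact: IH].
by rewrite dv kos_h0 oppr0; exact: kos_deg0.
Qed.

Lemma kos_in_lin N l a (u v : kos l) : ideal N ->
  kos_in N u -> kos_in N v -> kos_in N (a *: u + v).
Proof.
move=> iN; elim: l u v => [|b l IH] u v /=.
  by move=> Nu Nv; exact: idealD iN (idealM a iN Nu) Nv.
by move=> [? ?] [? ?]; split; exact: IH.
Qed.

Lemma kos_in0 N l : ideal N -> kos_in N (0 : kos l).
Proof. by move=> iN; elim: l => [|a l IH]; [exact: ideal0 | split]. Qed.

Lemma kos_in_submodule N l : ideal N -> submodule (@kos_in N l).
Proof.
move=> iN; split; first exact: kos_in0.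
  by move=> u v du dv; rewrite -[u]scale1r; exact: kos_in_lin.
by move=> a u du; rewrite -[_ *: _]addr0; apply: kos_in_lin => //; exact: kos_in0.
Qed.

Lemma kos_in_d N l (u : kos l) : ideal N -> kos_in N u -> kos_in N (kos_d u).
Proof.
move=> iN; elim: l u => [|a l IH] u; first by move=> _; exact: ideal0.
move=> [/= du dv]; split=> /=; first by rewrite addrC; apply: kos_in_lin => //; exact: IH.
by apply: submoduleN; [exact: kos_in_submodule | exact: IH].
Qed.

Lemma kos_in_h N l k (u : kos l) : ideal N -> kos_in N u -> kos_in N (kos_h k u).
Proof.
move=> iN; elim: l k u => [|a l IH] k u; first by move=> _; exact: ideal0.
move=> [/= du dv]; case: k => [|k]; split=> //=; try exact: kos_in0; try exact: IH.
by apply: submoduleN; [exact: kos_in_submodule | exact: IH].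
Qed.

Lemma kos_inW N N' l (u : kos l) : N `<=` N' -> kos_in N u -> kos_in N' u.
Proof. by move=> NN'; elim: l u => [|a l IH] u /=; [exact: NN' | move=> [/IH ? /IH ?]]. Qed.

Lemma kos_in_cancel N y l (u : kos l) :
  (forall x, N (y * x) -> N x) -> kos_in N (y *: u) -> kos_in N u.
Proof.
move=> reg; elim: l u => [|a l IH] u /=; first exact: reg.
by move=> [/IH ? /IH ?].
Qed.

(** Chains with coefficients in [N' = N + (y)] split homogeneously into a part
    over [N] and a multiple of [y]. *)
Lemma kos_in_adjoin N N' y l i (u : kos l) : ideal N ->
  (forall x, N' x -> exists c, N (x - y * c)) ->
  kos_deg i u -> kos_in N' u -> exists p : kos l, kos_deg i p /\ kos_in N (u - y *: p).
Proof.
move=> iN adj; elim: l i u => [|a l IH] i u.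
  move=> /= [i0|u0] N'u; first by have [c Nc] := adj u N'u; exists c; split=> //; left.
  by exists 0; split; [right | rewrite u0 scaler0 subrr; exact: ideal0].
case: i => [|i] [/= du dv] [N'u N'v]; have [p [dp Np]] := IH _ _ du N'u.
  exists (p, 0); split=> //; split=> //=.
  by rewrite dv scaler0 subrr; exact: kos_in0.
have [q [dq Nq]] := IH _ _ dv N'v.
by exists (p, q); split=> //; split.
Qed.

(** Vanishing of the homology in degree [i] of the Koszul complex of [S/N],
    localized at the prime [P]. *)
Definition kos_acyclic P N l i : Prop := forall z : kos l,
  kos_deg i z -> kos_in N (kos_d z) ->
  exists2 s, ~ P s & exists2 w : kos l, kos_deg i.+1 w & kos_in N (s *: z - kos_d w).

(** The long exact homology sequence of multiplication by [y] makes [y]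
    injective on the homology in degree [i]; some power of it also acts as zero,
    since up to a unit at [P] it lies in the ideal of the sequence. *)
Lemma kos_acyclic_step P N N' l i y s0 t :
  prime_ideal P -> ideal N -> ideal N' -> N `<=` N' -> N' y ->
  (forall x, N' x -> exists c, N (x - y * c)) ->
  (forall x, N (y * x) -> N x) ->
  ~ P s0 -> ideal_gen [set` l] (s0 * y ^+ t) ->
  kos_acyclic P N' l i.+1 -> kos_acyclic P N l i.
Proof.
move=> [iP P1 pP] iN iN' NN' N'y adj reg Ps0 ly acyc z dz cz.
have sD := kos_deg_submodule l i.+1; have sI := kos_in_submodule l iN.
have sI' := kos_in_submodule l iN'.
have PM s s' : ~ P s -> ~ P s' -> ~ P (s * s') by move=> ? ? /pP[].
have cancel_y (u : kos l) : kos_deg i u -> kos_in N (kos_d u) ->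
    (exists2 s, ~ P s & exists2 w : kos l, kos_deg i.+1 w & kos_in N (s *: (y *: u) - kos_d w)) ->
    (exists2 s, ~ P s & exists2 w : kos l, kos_deg i.+1 w & kos_in N (s *: u - kos_d w)).
  move=> du cu [s Ps [w dw Nw]].
  have cw : kos_in N' (kos_d w).
    rewrite -[kos_d w](subKr (s *: (y *: u))); apply: submoduleB => //; last exact: kos_inW Nw.
    apply: submoduleZ => //.
    elim: l u {z dz cz sD sI acyc du cu w dw Nw ly sI'} => [|a l IH] u /=.
      by rewrite -[_ *: _]/(y * u); exact: idealMr.
    by split.
  have [s' Ps' [v dv N'v]] := acyc w dw cw.
  have [|p [dp Np]] := kos_in_adjoin iN adj _ N'v (i := i.+1).
    apply: submoduleB => //; first exact: submoduleZ.
    exact: kos_deg_d.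
  exists (s' * s); first exact: PM.
  exists p => //; apply: (kos_in_cancel reg).
  have -> : y *: (s' * s *: u - kos_d p) =
      s' *: (s *: (y *: u) - kos_d w) + kos_d (s' *: w - kos_d v - y *: p).
    rewrite !kos_dB kos_dd !kos_dZ subr0 !scalerBr addrA subrK !scalerA.
    by congr (_ *: _ - _); ring.
  by apply: submoduleD => //; [exact: submoduleZ | exact: kos_in_d].
have dYu k : kos_deg i (y ^+ k *: z) /\ kos_in N (kos_d (y ^+ k *: z)).
  split; first by apply: submoduleZ => //; exact: kos_deg_submodule.
  by rewrite kos_dZ; apply: submoduleZ.
suff : exists2 s, ~ P s & exists2 w : kos l, kos_deg i.+1 w
    & kos_in N (s *: (y ^+ t *: z) - kos_d w).
  elim: t {ly} => [|t IH]; first by rewrite expr0 scale1r.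
  rewrite exprS -scalerA => bd; apply: IH; have [? ?] := dYu t.
  exact: cancel_y.
have [c cE] := ideal_genE ly.
exists s0 => //; exists (\sum_k c k *: kos_h k z).
  by apply: submodule_sum => // k _; apply: submoduleZ => //; exact: kos_deg_h.
have -> : s0 *: (y ^+ t *: z) - kos_d (\sum_k c k *: kos_h k z) =
    \sum_k c k *: kos_h k (kos_d z).
  rewrite scalerA cE scaler_suml.
  rewrite (big_morph _ (@kos_dD l) (@kos_d0 l)) -sumrB; apply: eq_bigr => k _.
  rewrite kos_dZ -scalerA -scalerBr -(kos_homotopy z (ltn_ord k)).
  by rewrite [_ + kos_h _ _]addrC addrK.
by apply: submodule_sum => // k _; apply: submoduleZ => //; exact: kos_in_h.
Qed.

End Koszul.

(** * Depth sensitivity of the Koszul complex *)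

Section KoszulRegular.
Local Open Scope classical_set_scope.
Variable S : comNzRingType.
Implicit Types (l y : seq S) (P : set S).

Lemma ideal_gen_nil (x : S) : ideal_gen [set` [::]] x -> x = 0.
Proof. by move/ideal_genE => [c ->]; rewrite big_ord0. Qed.

Lemma ideal_gen_consP (b : S) l (x : S) : ideal_gen [set` b :: l] x <->
  exists c, ideal_gen [set` l] (x - b * c).
Proof.
split=> [/ideal_genE [c ->]|[c H]].
  exists (c ord0); rewrite big_ord_recl /= mulrC addrAC subrr add0r.
  apply: ideal_sum => [|i _]; first exact: ideal_gen_ideal.
  apply: (idealM _ (ideal_gen_ideal _)); apply: sub_ideal_gen; exact: (mem_nth 0 (ltn_ord i)).
rewrite -[x](subrK (b * c)).
have iG := ideal_gen_ideal [set` b :: l].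
apply: (idealD iG).
  by apply: (ideal_gen_min iG _ H) => z /= zl; apply: sub_ideal_gen; rewrite /= inE zl orbT.
by apply: (idealMr _ iG); apply: sub_ideal_gen; rewrite /= inE eqxx.
Qed.

Lemma ideal_gen_eq_mem (s s' : seq S) : s =i s' ->
  ideal_gen [set` s] = ideal_gen [set` s'].
Proof.
by move=> E; congr ideal_gen; apply/seteqP; split=> x /=; rewrite E.
Qed.

(** The homology in degree [i] vanishes modulo the first [j] entries of [y] when
    [i > j]: for all of [y] the complex is too short, and each entry removed
    costs one degree. *)
Lemma kos_acyclic_regular P l y :
  prime_ideal P -> regular_sequence y -> (size l <= size y)%N ->
  (forall k, (k < size y)%N -> exists s0 t, ~ P s0 /\ ideal_gen [set` l] (s0 * y`_k ^+ t)) ->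
  forall i, (0 < i)%N -> kos_acyclic P [set 0] l i.
Proof.
move=> pP [regy _] lely Hy.
suff H n j : (j + n)%N = size y -> forall i, (j < i)%N ->
    kos_acyclic P (ideal_gen [set` take j y]) l i.
  move=> i i0; have := H (size y) 0%N (add0n _) i i0; rewrite take0.
  suff -> : ideal_gen [set` [::]] = [set 0] :> set S by [].
  apply/seteqP; split=> x; first exact: ideal_gen_nil.
  by move=> ->; apply: ideal0; exact: ideal_gen_ideal.
elim: n j => [|n IH] j eqj i ltji.
  move=> z dz _; have -> : z = 0 by apply: kos_deg_size dz; lia.
  exists 1; first by case: pP.
  exists 0; first exact: kos_deg0.
  by rewrite kos_d0 scaler0 subrr; apply: kos_in0; exact: ideal_gen_ideal.
have ltj : (j < size y)%N by lia.
have [s0 [t [Ps0 ly]]] := Hy j ltj.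
have adj x : ideal_gen [set` take j.+1 y] x <-> exists c, ideal_gen [set` take j y] (x - y`_j * c).
  rewrite (take_nth 0) // -ideal_gen_consP.
  suff -> : ideal_gen [set` rcons (take j y) y`_j] = ideal_gen [set` y`_j :: take j y] by [].
  by apply: ideal_gen_eq_mem => z; rewrite mem_rcons.
apply: (@kos_acyclic_step _ P _ (ideal_gen [set` take j.+1 y]) l i y`_j s0 t) => //;
  try exact: ideal_gen_ideal.
- by move=> x xj; apply/adj; exists 0; rewrite mulr0 subr0.
- apply/adj; exists 1; rewrite mulr1 subrr; apply: ideal0; exact: ideal_gen_ideal.
- by move=> x /adj.
- by move=> x; exact: regy.
- by apply: IH => //; lia.
Qed.

Definition kos_exact l i : Prop := forall z : kos l,
  kos_deg i z -> kos_d z = 0 -> exists2 w : kos l, kos_deg i.+1 w & z = kos_d w.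

Lemma kos_in_zero l (u : kos l) : kos_in [set 0] u -> u = 0.
Proof. by elim: l u => [|a l IH] u //=; case: u => [u v] [/= /IH -> /IH ->]. Qed.

(** Exactness is a local property: the scalars that turn a given cycle into a
    boundary form an ideal, which lies in no maximal ideal. *)
Lemma kos_exact_of_local l i :
  (forall P, maximal_ideal P -> kos_acyclic P [set 0] l i) -> kos_exact l i.
Proof.
move=> H z dz cz.
pose J := [set s : S | exists2 w : kos l, kos_deg i.+1 w & s *: z = kos_d w].
have sD := kos_deg_submodule l i.+1.
have iJ : ideal J.
  split; first by exists 0; [exact: kos_deg0 | rewrite scale0r kos_d0].
    move=> s s' [w dw E] [w' dw' E']; exists (w + w'); first exact: submoduleD.
    by rewrite kos_dD -E -E' scalerDl.
  move=> a s [w dw E]; exists (a *: w); first exact: submoduleZ.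
  by rewrite kos_dZ -E scalerA.
suff [w dw] : J 1 by rewrite scale1r; exists w.
apply: ideal_full_of_maximal => // P mP.
have [|s Ps [w dw /kos_in_zero /eqP]] := H P mP z dz.
  rewrite cz; elim: (l) => [|a l' IH] //=.
by rewrite subr_eq0 => /eqP E; exists s => //; exists w.
Qed.

Lemma kos_deg_0 l c : kos_deg 0 (kos_0 l c).
Proof. by elim: l => [|a l IH]; [left | split]. Qed.

Lemma kos_deg_0P l (u : kos l) : kos_deg 0 u -> exists c, u = kos_0 l c.
Proof.
elim: l u => [|a l IH] u; first by exists u.
by case: u => [u v] [/= /IH [c ->] ->]; exists c.
Qed.

Lemma kos_0_lin l a c c' : kos_0 l (a * c + c') = a *: kos_0 l c + kos_0 l c'.
Proof. by elim: l => [|b l IH] //=; rewrite pairE /= IH scaler0 addr0. Qed.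

Lemma kos_0_inj l : injective (kos_0 l).
Proof. by elim: l => [|a l IH] c c' //= [/IH]. Qed.

Lemma kos_0_0 l : kos_0 l 0 = 0.
Proof. by elim: l => [|a l IH] //=; rewrite IH. Qed.

Lemma kos_0_mul l a c : kos_0 l (a * c) = a *: kos_0 l c.
Proof. by rewrite -[a * c]addr0 kos_0_lin kos_0_0 addr0. Qed.

Lemma kos_d_deg0 l (u : kos l) : kos_deg 0 u -> kos_d u = 0.
Proof.
elim: l u => [|a l IH] u //; case: u => [u v] [/= /IH -> ->].
by rewrite scaler0 addr0 kos_d0 oppr0.
Qed.

Lemma kos_d_1 l (z : kos l) : kos_deg 1 z ->
  exists2 c, ideal_gen [set` l] c & kos_d z = kos_0 l c.
Proof.
elim: l z => [|a l IH] z.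
  by exists 0 => //; apply: ideal0; exact: ideal_gen_ideal.
case: z => [u v] [/= /IH [c lc ->] dv]; have [c' vE] := kos_deg_0P dv.
exists (c + a * c'); last first.
  by rewrite /= [c + _]addrC kos_0_lin vE kos_d_deg0 ?oppr0; [rewrite addrC | exact: kos_deg_0].
by apply/ideal_gen_consP; exists c'; rewrite addrK.
Qed.

Lemma kos_d_1_surj l c : ideal_gen [set` l] c ->
  exists2 z : kos l, kos_deg 1 z & kos_d z = kos_0 l c.
Proof.
move=> /ideal_genE [e ->].
exists (\sum_k e k *: kos_h k (kos_0 l 1)).
  apply: submodule_sum => [|k _]; first exact: kos_deg_submodule.
  apply: submoduleZ; first exact: kos_deg_submodule.
  by apply: kos_deg_h; exact: kos_deg_0.
rewrite (big_morph _ (@kos_dD _ l) (@kos_d0 _ l)).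
transitivity (\sum_k kos_0 l (e k * l`_k)); last first.
  symmetry; apply: (big_morph _ _ (kos_0_0 l)) => x y.
  by rewrite -[x]mul1r kos_0_lin scale1r mul1r.
apply: eq_bigr => k _; rewrite kos_dZ kos_0_mul; congr (_ *: _).
have := kos_homotopy (kos_0 l 1) (ltn_ord k).
rewrite (kos_d_deg0 (kos_deg_0 l 1)) kos_h0 addr0.
by move=> ->; rewrite -[in RHS](mulr1 l`_k) kos_0_mul.
Qed.

(** If [a c] is the boundary of [z], then [z - e_a c] is a cycle of the cone, and a
    chain that it bounds exhibits [c] as an element of the ideal. *)
Lemma kos_exact_regular a l c : kos_exact (a :: l) 1 ->
  ideal_gen [set` l] (a * c) -> ideal_gen [set` l] c.
Proof.
move=> ex /kos_d_1_surj [z dz zE].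
have [||w [/= dw1 dw2] [_]] := ex (z, - kos_0 l c).
- by split=> //=; exact: (submoduleN (kos_deg_submodule l 0) (kos_deg_0 l c)).
- rewrite /= zE kos_0_mul scalerN subrr kos_dN kos_d_deg0 ?oppr0 //; exact: kos_deg_0.
- by have [c' lc' ->] := kos_d_1 dw2 => /oppr_inj /kos_0_inj ->.
Qed.

(** The cycles [Z] of degree one of the shorter complex satisfy
    [Z = aZ + boundaries], whence they are boundaries by Nakayama's lemma. *)
Lemma kos_exact_behead a l : noetherian S ->
  (forall P, maximal_ideal P -> P a) -> kos_exact (a :: l) 1 -> kos_exact l 1.
Proof.
move=> noethS aP ex.
pose Z := [set z : kos l | kos_deg 1 z /\ kos_d z = 0].
pose Bd := [set z : kos l | exists2 w : kos l, kos_deg 2 w & z = kos_d w].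
have sD1 := kos_deg_submodule l 1; have sD2 := kos_deg_submodule l 2.
have sZ : submodule Z.
  split; first by split; [exact: kos_deg0 | exact: kos_d0].
    by move=> u v [du cu] [dv cv]; split; [exact: submoduleD | rewrite kos_dD cu cv addr0].
  by move=> x u [du cu]; split; [exact: submoduleZ | rewrite kos_dZ cu scaler0].
have sB : submodule Bd.
  split; first by exists 0; [exact: kos_deg0 | rewrite kos_d0].
    by move=> _ _ [u du ->] [v dv ->]; exists (u + v); [exact: submoduleD | rewrite kos_dD].
  by move=> x _ [u du ->]; exists (x *: u); [exact: submoduleZ | rewrite kos_dZ].
have nK : noetherian_module (kos l).
  by elim: (l) => [|b l' IH]; [exact: noetherian_regular | exact: noetherian_pair].
have [s sE] := nK Z sZ.
suff H x : x \in s -> Bd x.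
  move=> z dz cz; suff : span [set` s] `<=` Bd by apply; rewrite -sE.
  by apply: span_min.
apply: (nakayama (principal_ideal a)) => {x} // [_ [c ->]|x xs].
  apply: unit_of_maximal => P mP Pu; have [iP P1 _] := mP; apply: P1.
  rewrite -(subrK (c * a) 1); apply: idealD => //; apply: idealM => //; exact: aP.
have [dx cx] : Z x by rewrite sE; exact: sub_span.
have [||[u v] [/= du dv] [xE vE]] := ex (x, 0).
- by split=> //; exact: kos_deg0.
- by rewrite /= cx scaler0 addr0 kos_d0 oppr0.
have [e vsE] : exists e : 'I_(size s) -> S, v = \sum_i e i *: s`_i.
  apply: span_seqP; rewrite -sE; split=> //.
  by apply: oppr_inj; rewrite -vE oppr0.
exists (fun i => (if insub i is Some j then e j else 0) * a); split; first by move=> i; eexists.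
exists u => //; rewrite xE vsE scaler_sumr -[RHS]addr0; rewrite -addrA; congr (_ + _).
apply/eqP; rewrite subr_eq0; apply/eqP; apply: eq_bigr => i _.
by rewrite valK scalerA mulrC.
Qed.

Lemma kos_exact_drop_regular l : noetherian S ->
  (forall P x, maximal_ideal P -> x \in l -> P x) -> kos_exact l 1 ->
  forall j x, (j < size l)%N ->
    ideal_gen [set` drop j.+1 l] (l`_j * x) -> ideal_gen [set` drop j.+1 l] x.
Proof.
move=> noethS; elim: l => [//|a l IH] lP ex [|j] x /= ltj.
  by rewrite drop0; exact: kos_exact_regular.
apply: IH => // [P y mP yl|]; first by apply: lP => //; rewrite inE yl orbT.
by apply: kos_exact_behead ex => // P mP; apply: lP => //; rewrite inE eqxx.
Qed.

End KoszulRegular.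

(** * Regular sequences are quasi-regular *)

Section QuasiRegular.
Local Open Scope classical_set_scope.
Variables (S : comNzRingType) (d : nat) (a : d.-tuple S).

Let tail_ideal j := ideal_gen [set` drop j a].

Lemma tail_ideal_ideal j : ideal (tail_ideal j).
Proof. exact: ideal_gen_ideal. Qed.

Lemma tail_idealS j : tail_ideal j.+1 `<=` tail_ideal j.
Proof.
apply: ideal_gen_min; first exact: tail_ideal_ideal.
move=> x /= xs; apply: sub_ideal_gen => /=.
by rewrite -addn1 addnC -drop_drop in xs; exact: mem_drop xs.
Qed.

Lemma form_split j k (ltj : (j < d)%N) (g : {mpoly S[d]}) :
  form j k.+1 setT g -> exists g' h, [/\ g = g' + 'X_(Ordinal ltj) * h,
    form j.+1 k.+1 setT g' & form j k setT h].
Proof.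
move=> fg; set i := Ordinal ltj.
exists (\sum_(b <- msupp g | b i == 0%N) g@_b *: 'X_[b]).
exists (\sum_(b <- msupp g | b i != 0%N) g@_b *: 'X_[(b - U_(i))%MM]).
have iT := ideal_setT S; split.
- rewrite {1}[g]mpolyE (bigID (fun b : 'X_{1..d} => b i == 0%N)) /=; congr (_ + _).
  rewrite mulr_sumr; apply: eq_bigr => b bi.
  by rewrite -scalerAr -mpolyXD addmC submK //; apply/mnm_lepP => i'; rewrite mnm1E; case: eqP => // <-; rewrite lt0n.
- apply: (big_ind (form j.+1 k.+1 setT)); [exact: form0 | by move=> *; exact: formD | ].
  move=> b /eqP bi; have [->|nb] := eqVneq g@_b 0; first by rewrite scale0r; exact: form0.
  have [_ /(_ nb) /andP[/eqP <- /free_belowP fb]] := fg b.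
  apply: formZ => //; apply: formX; apply/free_belowP => i'; rewrite ltnS leq_eqVlt.
  by case/orP=> [/eqP E|/fb //]; rewrite -bi; congr (b _); apply: val_inj.
- apply: (big_ind (form j k setT)); [exact: form0 | by move=> *; exact: formD | ].
  move=> b bi; have [->|nb] := eqVneq g@_b 0; first by rewrite scale0r; exact: form0.
  have [_ /(_ nb) /andP[/eqP bk /free_belowP fb]] := fg b.
  have -> : k = mdeg (b - U_(i))%MM.
    have leU : (U_(i) <= b)%MM by apply/mnm_lepP => i'; rewrite mnm1E; case: eqP => // <-; rewrite lt0n.
    by have := congr1 mdeg (submK leU); rewrite mdegD mdeg1 bk; lia.
  apply: formZ => //; apply: formX; apply/free_belowP => i' /fb E.
  by rewrite mnmBE E.
Qed.

Hypothesis regular : forall j x, (j < d)%N ->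
  tail_ideal j.+1 (a`_j * x) -> tail_ideal j.+1 x.

Let quasi_regular_at j := forall k g, form j k setT g ->
  ideal_exp (tail_ideal j) k.+1 g.@[tnth a] -> forall b, tail_ideal j g@_b.

Let quasi_regular0_at j k := forall g, form j k setT g ->
  g.@[tnth a] = 0 -> forall b, tail_ideal j g@_b.

(** Values in [Q^(k+1)] can be subtracted, as those of forms with coefficients in
    [Q], so only relations with value zero matter. *)
Lemma quasi_regular_of0 j k : quasi_regular0_at j k ->
  forall g, form j k setT g -> ideal_exp (tail_ideal j) k.+1 g.@[tnth a] ->
  forall b, tail_ideal j g@_b.
Proof.
move=> qr0 g fg; have -> : ideal_exp (tail_ideal j) k.+1 = ideal_mul (tail_ideal j) (ideal_exp (tail_ideal j) k) by [].
rewrite ideal_mul_expE; last exact: tail_ideal_ideal.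
move=> [h fh E] b; have iT := ideal_setT S; have iG := tail_ideal_ideal j.
have /(_ b) : forall b, tail_ideal j (g - h)@_b.
  apply: qr0; last by rewrite mevalB E subrr.
  by apply: formB => //; exact: formW fh.
by rewrite mcoeffB => H; rewrite -(subrK h@_b g@_b); apply: (idealD iG) => //; exact: form_coef fh.
Qed.

(** By quasi-regularity the layers [Q^k / Q^(k+1)] are free over the quotient by
    [Q], so regularity modulo [Q] climbs from each power to the next. *)
Lemma regular_mod_power j k x : (j < d)%N -> quasi_regular_at j.+1 ->
  ideal_exp (tail_ideal j.+1) k (a`_j * x) -> ideal_exp (tail_ideal j.+1) k x.
Proof.
move=> ltj qr; elim: k => [//|k IH] H.
have := IH (ideal_expSS H); rewrite ideal_exp_formE => -[h fh hE].
have iG := tail_ideal_ideal j.+1.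
have -> : ideal_exp (tail_ideal j.+1) k.+1 = ideal_mul (tail_ideal j.+1) (ideal_exp (tail_ideal j.+1) k) by [].
rewrite ideal_mul_expE // -hE; exists h => //; apply: (formJ fh) => b.
apply: (regular ltj); rewrite -mcoeffZ; apply: (qr k); first exact: formZ (ideal_setT S) fh.
by rewrite mevalZ hE.
Qed.

(** A relation [g'(a) + a_j h(a) = 0], with [g'] free of [X_j], puts [h(a)] into a
    power of the smaller ideal. This bounds the coefficients of [h] by induction
    on the degree, and allows [h(a)] to be rewritten without [X_j], which reduces
    the relation to one in fewer variables. *)
Lemma quasi_regular_step j : (j < d)%N -> quasi_regular_at j.+1 -> quasi_regular_at j.
Proof.
move=> ltj qr; suff qr0 k : quasi_regular0_at j k by move=> k; exact: quasi_regular_of0.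
elim: k => [|k IH] g fg g0 b.
  have iG := tail_ideal_ideal j; have [b0|nb] := eqVneq b 0%MM; last first.
    rewrite (form_coef0 fg); first exact: ideal0.
    by rewrite mdeg_eq0 (negPf nb).
  suff <- : g.@[tnth a] = g@_b by rewrite g0; exact: ideal0.
  have -> : g = (g@_b)%:MP.
    apply/mpolyP => c; rewrite mcoeffC b0; have [->|nc] := eqVneq c 0%MM; first by rewrite mulr1.
    by rewrite mulr0 (form_coef0 fg) // mdeg_eq0 (negPf nc).
  by rewrite mevalC mcoeffC b0 eqxx mulr1.
have [g' [h [gE fg' fh]]] := form_split ltj fg.
have iT := ideal_setT S; have iG := tail_ideal_ideal j; have iG1 := tail_ideal_ideal j.+1.
have evE : a`_j * h.@[tnth a] = - g'.@[tnth a].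
  move: g0; rewrite gE mevalD mevalM mevalXU (tnth_nth 0) => /eqP.
  by rewrite addrC addr_eq0 => /eqP.
have hQ1 : ideal_exp (tail_ideal j.+1) k.+1 h.@[tnth a].
  apply: (regular_mod_power ltj qr); rewrite evE; apply: (idealN (ideal_exp_ideal _ _)).
  by rewrite ideal_exp_formE; exists g'.
have hG : forall c, tail_ideal j h@_c.
  apply: (quasi_regular_of0 IH fh); apply: ideal_expS hQ1; exact: tail_idealS.
have [h' fh' hE] : [set g.@[tnth a] | g in form j.+1 k.+1 setT] h.@[tnth a].
  by rewrite -ideal_exp_formE.
have /(_ b) Gb : forall b, tail_ideal j.+1 (g' + a`_j *: h')@_b.
  apply: (qr k.+1); first by apply: formD => //; exact: formZ.
  have -> : (g' + a`_j *: h').@[tnth a] = 0.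
    by rewrite mevalD mevalZ hE evE addrN.
  by apply: ideal0; exact: ideal_exp_ideal.
have aj : tail_ideal j a`_j.
  apply: sub_ideal_gen => /=; have := @mem_drop_tnth _ _ a j (Ordinal ltj) (leqnn _).
  by rewrite (tnth_nth 0).
rewrite gE mcoeffD; apply: (idealD iG).
  rewrite -(addrK (a`_j * h'@_b) g'@_b) -mcoeffZ -mcoeffD; apply: (idealB iG).
    exact: tail_idealS.
  by rewrite mcoeffZ; exact: (idealMr _ iG).
rewrite mcoeffM; apply: (ideal_sum _ iG) => p _; exact: (idealM _ iG).
Qed.

Lemma quasi_regular k g : form 0 k setT g ->
  ideal_exp (ideal_gen [set` a]) k.+1 g.@[tnth a] ->
  forall b, ideal_gen [set` a] g@_b.
Proof.
suff H n j : (j + n)%N = d -> quasi_regular_at j.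
  by have := H d 0%N (add0n d); rewrite /quasi_regular_at /tail_ideal drop0; exact.
elim: n j => [|n IH] j E; last by apply: quasi_regular_step; [lia | apply: IH; lia].
have t0 x : tail_ideal j x -> x = 0.
  have le : (size a <= j)%N by rewrite size_tuple -E addn0.
  by rewrite /tail_ideal (drop_oversize le); exact: ideal_gen_nil.
move=> {}k {}g fg H b; suff -> : g@_b = 0 by apply: ideal0; exact: tail_ideal_ideal.
have b0 (c : 'X_{1..d}) : free_below j c -> c = 0%MM.
  move=> /free_belowP fc; apply/mnmP => i; rewrite mnm0E; by apply: fc; rewrite -[j]addn0 E; exact: ltn_ord.
have g0 : g.@[tnth a] = 0.
  by apply: t0; apply: ideal_mul_subl H; exact: tail_ideal_ideal.
have [bE|nb] := eqVneq b 0%MM; last first.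
  apply: (form_coef0 fg); apply/negP => /andP[_ /b0 E0].
  by rewrite E0 eqxx in nb.
rewrite -g0; have -> : g = (g@_b)%:MP.
  apply/mpolyP => c; rewrite mcoeffC bE; have [->|nc] := eqVneq c 0%MM; first by rewrite mulr1.
  rewrite mulr0; apply: (form_coef0 fg); apply/negP => /andP[_ /b0 E0].
  by rewrite E0 eqxx in nc.
by rewrite mevalC mcoeffC bE eqxx mulr1.
Qed.

End QuasiRegular.

(** * Cancelling a form with a unit coefficient *)

Section Cancellation.
Local Open Scope classical_set_scope.
Variables (S : comNzRingType) (d : nat) (f : {mpoly S[d]}) (M : set S).
Variables (b0 : 'X_{1..d}) (u : S).
Hypotheses (f_unit : u * f@_b0 = 1)
  (f_above : forall b, (b0 < b)%O -> M f@_b).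

(** Filtering by the powers of [M], the leading term of [g] is multiplied by the
    unit coefficient of [f] in each layer. *)
Lemma unit_form_cancel (J : set S) t (g : {mpoly S[d]}) :
  ideal J -> ideal_exp M t `<=` J -> (forall b, J (f * g)@_b) ->
  forall b, J g@_b.
Proof.
move=> iJ MJ Jfg.
pose T i := [set x + y | x in ideal_exp M i & y in J].
have iT i : ideal (T i) by exact: (addset_submodule (ideal_exp_ideal M i) iJ).
have JT i : J `<=` T i.
  by move=> x Jx; exists 0; [apply: ideal0; exact: ideal_exp_ideal | exists x; rewrite ?add0r].
have MT i x y : M x -> T i y -> T i.+1 (x * y).
  move=> Mx [v Mv [w Jw <-]]; exists (x * v); first exact: mem_ideal_mul.
  by exists (x * w); [exact: idealM | rewrite mulrDr].
suff H i b : T i g@_b.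
  by move=> b; have [x /MJ Jx [y Jy <-]] := H t b; exact: idealD.
elim: i b => [|i IH] b.
  by exists g@_b => //; exists 0; [exact: ideal0 | rewrite addr0].
apply: contrapT => nT.
have [||c [nTc maxc]] := @mpoly_max _ _ g (fun b => ~ T i.+1 g@_b).
- by move=> b'; apply: contra_notN => /eqP ->; exact: ideal0.
- by exists b.
have Tabove c' : (c < c')%O -> T i.+1 g@_c'.
  by move=> lt; apply: contrapT => /maxc; rewrite leNgt lt.
apply: nTc; rewrite -[g@_c]mul1r -f_unit -mulrA; apply: (idealM _ (iT _)).
rewrite -[_ * _](subKr (f * g)@_(b0 + c)); apply: (idealB (iT _)).
  exact: JT.
apply: mcoeffM_lead => // b' c' _ lt; first by apply: MT; [exact: f_above | exact: IH].
by apply: (idealM _ (iT _)); exact: Tabove.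
Qed.

Variables (a : d.-tuple S) (e : nat).
Hypothesis f_form : form 0 e setT f.
Let Q := ideal_gen [set` a].
Hypothesis a_quasi_regular : forall k g, form 0 k setT g ->
  ideal_exp Q k.+1 g.@[tnth a] -> forall b, Q g@_b.

(** First [x] climbs to [Q^n] one power at a time: quasi-regularity puts the
    coefficients of [f g] into [Q] whenever [x = g(a)] is still below [Q^n], hence
    those of [g] as well. In degree [n] the same comparison is made modulo [K]. *)
Lemma quasi_regular_cancel (K : set S) t n x :
  ideal K -> Q `<=` K -> ideal_exp M t `<=` Q ->
  ideal_mul K (ideal_exp Q (n + e)) (f.@[tnth a] * x) ->
  ideal_mul K (ideal_exp Q n) x.
Proof.
move=> iK QK MQ KQx; have iQ : ideal Q := ideal_gen_ideal _.
have QE J k : ideal J -> ideal_mul J (ideal_exp Q k) = [set g.@[tnth a] | g in form 0 k J].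
  by move=> iJ; rewrite -ideal_mul_expE // drop0.
have QE' k : ideal_exp Q k = [set g.@[tnth a] | g in form 0 k setT].
  by rewrite -QE // ideal_mulTl //; exact: ideal_exp_ideal.
have iT := ideal_setT S.
have Qx j : (j <= n)%N -> ideal_exp Q j x.
  elim: j => [//|j IH] lejn; have := IH (ltnW lejn).
  rewrite QE' => -[g fg gE].
  have -> : ideal_exp Q j.+1 = ideal_mul Q (ideal_exp Q j) by [].
  rewrite QE //; exists g => //; apply: (formJ fg).
  apply: (unit_form_cancel iQ MQ); apply: (a_quasi_regular (k := e + j)).
    by apply: formM.
  rewrite mevalM gE.
  have le : (((e + j).+1) <= n + e)%N by rewrite addnC -addSn leq_add2r.
  apply: (ideal_exp_dec le); move: KQx; apply: ideal_mul_subr; exact: ideal_exp_ideal.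
have [g fg gE] : [set g.@[tnth a] | g in form 0 n setT] x by rewrite -QE'; exact: Qx.
rewrite QE //; exists g => //; apply: (formJ fg).
have MK : ideal_exp M t `<=` K by apply: subset_trans QK.
apply: (unit_form_cancel iK MK) => b.
move: KQx; rewrite QE // => -[h fh hE].
have /(_ b) : forall b, Q (f * g - h)@_b.
  apply: (a_quasi_regular (k := n + e)).
    apply: formB => //; last exact: formW fh.
    by rewrite addnC; exact: formM.
  rewrite mevalB mevalM gE hE subrr; apply: ideal0; exact: ideal_exp_ideal.
rewrite mcoeffB => /QK H; rewrite -(subrK h@_b (f * g)@_b).
by apply: (idealD iK) => //; exact: form_coef fh.
Qed.

End Cancellation.

(** * Extension of ideals along a finite morphism *)

Section Extension.
Local Open Scope classical_set_scope.
Variables (R S : comNzRingType) (phi : {rmorphism R -> S}).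
Implicit Types (J K : set R).

Lemma ideal_ext_ideal J : ideal (ideal_ext phi J).
Proof. exact: ideal_gen_ideal. Qed.

Lemma mem_ideal_ext J x : J x -> ideal_ext phi J (phi x).
Proof. by move=> Jx; apply: sub_ideal_gen; exists x. Qed.

Lemma ideal_ext_min J (N : set S) : ideal N ->
  (forall x, J x -> N (phi x)) -> ideal_ext phi J `<=` N.
Proof. by move=> iN H; apply: ideal_gen_min => // _ [x Jx <-]; exact: H. Qed.

Lemma preimage_ideal (N : set S) : ideal N -> ideal [set x | N (phi x)].
Proof.
move=> iN; split; rewrite /=; first by rewrite rmorph0; exact: ideal0.
  by move=> x y Nx Ny; rewrite rmorphD; exact: idealD.
by move=> c x Nx; rewrite -[c *: x]/(c * x) rmorphM; exact: idealM.
Qed.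

Lemma ideal_extS J K : J `<=` K -> ideal_ext phi J `<=` ideal_ext phi K.
Proof.
move=> JK; apply: ideal_ext_min; first exact: ideal_ext_ideal.
by move=> x /JK; exact: mem_ideal_ext.
Qed.

Lemma ideal_ext_gen (s : seq R) :
  ideal_ext phi (ideal_gen [set` s]) = ideal_gen [set` map phi s].
Proof.
apply/seteqP; split.
  apply: ideal_ext_min => [|x sx]; first exact: ideal_gen_ideal.
  have iG := preimage_ideal (ideal_gen_ideal [set` map phi s]).
  apply: (ideal_gen_min iG _ sx) => y /= ys; apply: sub_ideal_gen => /=.
  exact: map_f.
apply: ideal_gen_min; first exact: ideal_ext_ideal.
by move=> _ /= /mapP[y ys ->]; apply: mem_ideal_ext; exact: sub_ideal_gen.
Qed.

Lemma ideal_ext_mul J K : ideal_ext phi (ideal_mul J K) =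
  ideal_mul (ideal_ext phi J) (ideal_ext phi K).
Proof.
have iM := ideal_mul_ideal (ideal_ext phi J) (ideal_ext phi K).
apply/seteqP; split.
  apply: ideal_ext_min => // x JKx.
  apply: (ideal_mul_min (preimage_ideal iM) _ JKx) => y z Jy Kz /=.
  by rewrite rmorphM; apply: mem_ideal_mul; exact: mem_ideal_ext.
have iE := ideal_ext_ideal (ideal_mul J K).
apply: ideal_mul_min => // x y Jx.
suff : ideal_ext phi K `<=` [set y | ideal_ext phi (ideal_mul J K) (x * y)] by exact.
apply: ideal_ext_min => [|z Kz /=].
  split; rewrite /=; first by rewrite mulr0; exact: (ideal0 iE).
    by move=> v w Ev Ew; rewrite mulrDr; exact: (idealD iE Ev Ew).
  by move=> c v Ev; rewrite -[c *: v]/(c * v) mulrCA; exact: (idealM _ iE Ev).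
suff : ideal_ext phi J `<=` [set x | ideal_ext phi (ideal_mul J K) (x * phi z)] by exact.
apply: ideal_ext_min => [|w Jw /=].
  split; rewrite /=; first by rewrite mul0r; exact: (ideal0 iE).
    by move=> v w Ev Ew; rewrite mulrDl; exact: (idealD iE Ev Ew).
  by move=> c v Ev; rewrite -[c *: v]/(c * v) -mulrA; exact: (idealM _ iE Ev).
by rewrite -rmorphM; apply: mem_ideal_ext; exact: mem_ideal_mul.
Qed.

Lemma ideal_ext_exp J n : ideal_ext phi (ideal_exp J n) = ideal_exp (ideal_ext phi J) n.
Proof.
elim: n => [|n IH]; last by rewrite [RHS]/= -IH -ideal_ext_mul.
rewrite (ideal_full (ideal_ext_ideal _)) // -(rmorph1 phi).
exact: mem_ideal_ext.
Qed.

Lemma restr_submodule (N : set S) : ideal N -> submodule (N : set (restr phi)).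
Proof. by move=> iN; split; [exact: ideal0|move=> *; exact: idealD|move=> *; exact: idealM]. Qed.

(** Each of the [size s] generators of [S] gives a map from [A/B] to the
    extended quotient, and these maps are jointly surjective. *)
Lemma ext_length_le (s : seq (restr phi)) (A B : set R) n :
  span [set` s] = setT -> ideal A -> ideal B -> B `<=` A ->
  length_le (A : set R^o) (B : set R^o) n ->
  length_le (ideal_ext phi A : set (restr phi)) (ideal_ext phi B) (size s * n).
Proof.
move=> sT iA iB BA hn.
have iEA := ideal_ext_ideal A; have iEB := ideal_ext_ideal B.
pose gen (x : restr phi) := fun c : R^o => (c : R) *: x.
pose fs := [seq gen x | x <- s].
rewrite -[size s](size_map gen) -/fs.
have fsE k : (k < size s)%N -> nth (fun=> 0) fs k = gen s`_k.
  by move=> lt; rewrite (nth_map 0).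
have iE0 k (c : R) J : J c -> ideal_ext phi J (c *: (s`_k : restr phi)).
  by move=> Jc; apply: (idealMr _ (ideal_ext_ideal _)); exact: mem_ideal_ext.
apply: length_le_cover hn => //; try exact: restr_submodule.
- exact: ideal_extS.
- move=> k; rewrite size_map => lt; rewrite /= fsE //; split.
  + by move=> c x y; rewrite /gen scalerDl scalerA.
  + by move=> _ [c Ac <-]; exact: iE0.
  + by move=> _ [c Bc <-]; exact: iE0.
set U := foldl _ _ _.
pose G := [set x : S | exists2 c : nat -> R, (forall k, A (c k)) &
  x = \sum_(k < size s) c k *: (s`_k : restr phi)].
have GU : G `<=` U.
  move=> _ [c Ac ->].
  have -> : \sum_(k < size s) c k *: (s`_k : restr phi) =
      \sum_(k < size fs) nth (fun=> 0) fs k (c k) + 0.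
    by rewrite addr0 size_map; apply: eq_bigr => k _; rewrite fsE.
  by apply: cover_sum => //; exact: ideal0.
apply: subset_trans GU; apply: ideal_gen_min => [|_ [x Ax <-]].
  split.
  - by exists (fun=> 0); [move=> _; exact: ideal0 | rewrite big1 // => k _; rewrite scale0r].
  - move=> _ _ [c Ac ->] [c' Ac' ->]; exists (fun k => c k + c' k); first by move=> k; exact: idealD.
    by rewrite -big_split; apply: eq_bigr => k _; rewrite scalerDl.
  - move=> z _ [c Ac ->].
    have ex k : exists e : nat -> R, z * (s`_k : S) = \sum_(i < size s) e i *: (s`_i : restr phi).
      have [e eE] : exists e : 'I_(size s) -> R, (z * (s`_k : S) : restr phi) = \sum_i e i *: s`_i.
        by apply: span_seqP; rewrite sT.
      exists (fun i => if insub i is Some j then e j else 0); rewrite eE.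
      by apply: eq_bigr => i _; rewrite valK.
    pose e k := projT1 (cid (ex k)).
    have eE k : z * (s`_k : S) = \sum_(i < size s) e k i *: (s`_i : restr phi) := projT2 (cid (ex k)).
    exists (fun i => \sum_(k < size s) c k * e k i).
      by move=> i; apply: ideal_sum => // k _; exact: idealMr.
    rewrite -[z *: _]/(z * _) mulr_sumr.
    transitivity (\sum_(k < size s) c k *: (\sum_(i < size s) e k i *: (s`_i : restr phi))).
      apply: eq_bigr => k _; rewrite -eE.
      rewrite -[c k *: s`_k]/(phi (c k) * (s`_k : S)) -[RHS]/(phi (c k) * (z * (s`_k : S))).
      by rewrite mulrCA.
    under eq_bigr => k _ do rewrite scaler_sumr.
    rewrite exchange_big /=; apply: eq_bigr => i _.
    by rewrite scaler_suml; apply: eq_bigr => k _; rewrite scalerA.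
have [e eE] : exists e : 'I_(size s) -> R, (1 : restr phi) = \sum_i e i *: s`_i.
  by apply: span_seqP; rewrite sT.
exists (fun i => x * (if insub i is Some j then e j else 0)).
  by move=> k; exact: idealMr.
rewrite -[phi x]mulr1 -[LHS]/(x *: (1 : restr phi)) eE scaler_sumr.
by apply: eq_bigr => i _; rewrite valK scalerA.
Qed.

End Extension.

(** * Finite extensions of a local ring *)

Section FiniteMorphism.
Local Open Scope classical_set_scope.
Variables (R S : comNzRingType) (m : set R) (phi : {rmorphism R -> S}).
Hypotheses (noethR : noetherian R) (localm : local_ring m).
Hypothesis finite_phi : finite_morphism phi.

(** Otherwise [S/P] would equal its multiple by [m], against Nakayama's lemma over
    [R]. *)
Lemma maximal_lies_over (P : set S) x : maximal_ideal P -> m x -> P (phi x).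
Proof.
move=> mP mx; apply: contrapT => nPx; have [iP P1 _] := mP.
have [c Pc] := maximal_comaximal mP nPx; have [s sT] := finite_phi.
have im := local_ideal localm; have [_ m1 _] := local_prime localm.
have mrad e : m e -> exists u, u * (1 - e) = 1.
  move=> me; apply: (local_unit localm) => m1e; apply: m1.
  by rewrite -(subrK e 1); exact: idealD.
have sP := restr_submodule phi iP.
have Ps y : y \in s -> P y.
  apply: (nakayama im mrad sP) => {}y ys.
  have [e eE] : exists e : 'I_(size s) -> R, (c * (y : S) : restr phi) = \sum_i e i *: s`_i.
    by apply: span_seqP; rewrite sT.
  exists (fun i => x * (if insub i is Some j then e j else 0)); split.
    by move=> i; exact: idealMr.
  have -> : \sum_(i < size s) (x * (if insub (i : nat) is Some j then e j else 0)) *: s`_i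
      = x *: (c * (y : S) : restr phi).
    by rewrite eE scaler_sumr; apply: eq_bigr => i _; rewrite valK scalerA.
  rewrite -[x *: _]/(phi x * (c * (y : S))) mulrCA mulrA.
  rewrite -[X in P (X - _)]mul1r -[_ - _]/(1 * (y : S) - (c * phi x) * (y : S)) -mulrBl.
  exact: idealMr.
by apply: P1; apply: (span_min sP Ps); rewrite sT.
Qed.

Lemma quotient_length t (K : set R) : ideal_exp m t `<=` K ->
  exists n, length_le (setT : set R^o) (K : set R^o) n.
Proof.
move=> mK; have [n hn] := power_length localm noethR t; exists n => -[N [CN ltN]].
apply: hn; exists N; split=> // i lei; have [sN KN _] := CN i lei.
by split=> //; exact: subset_trans KN.
Qed.

(** The descending chain of the ideals generated by [QS] and [y^k] stops, because
    [S/QS] has finite length. *)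
Lemma parameter_power t (Q : set R) (P : set S) y :
  ideal Q -> ideal_exp m t `<=` Q -> maximal_ideal P -> P y ->
  exists s0 k, ~ P s0 /\ ideal_ext phi Q (s0 * y ^+ k).
Proof.
move=> iQ mQ [iP P1 _] Py; have [s sT] := finite_phi.
have [n hn] := quotient_length mQ.
have iE := ideal_ext_ideal phi Q.
have hS := ext_length_le sT (ideal_setT R) iQ (fun=> fun=> I) hn.
set L := (size s * n)%N in hS.
pose N k : set S := [set z | exists c, ideal_ext phi Q (z - c * y ^+ k)].
have iN k : ideal (N k).
  split; first by exists 0; rewrite mul0r subrr; exact: (ideal0 iE).
    move=> z z' [c Nz] [c' Nz']; exists (c + c').
    by rewrite mulrDl opprD addrACA; exact: (idealD iE).
  by move=> e z [c Nz]; exists (e * c); rewrite -mulrA -mulrBr; exact: (idealM _ iE).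
have NS k : N k.+1 `<=` N k.
  by move=> z [c Nz]; exists (c * y); rewrite -mulrA -exprS.
have [k Nk] : exists k, N k `<=` N k.+1.
  apply: contrapT => nex; apply: hS; exists (fun i => N (L.+1 - i)%N); split=> i lei.
    split=> //; first exact: restr_submodule.
    - by move=> z Ez; exists 0; rewrite mul0r subr0.
    - by move=> z _; rewrite (ideal_full (ideal_ext_ideal _ _)) // -(rmorph1 phi); exact: mem_ideal_ext.
  by rewrite subSn //; split=> [|H]; [exact: NS | apply: nex; exists (L - i)%N].
have [|c Ec] := Nk (y ^+ k).
  by exists 1; rewrite mul1r subrr; exact: (ideal0 iE).
exists (1 - c * y), k; split; last by rewrite mulrBl mul1r -mulrA -exprS.
move=> Pc; apply: P1; rewrite -(subrK (c * y) 1); apply: (idealD iP) => //.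
exact: idealM.
Qed.

Hypothesis CM : cohen_macaulay S.

(** At a maximal ideal [P] of height [d] there is a regular sequence of length
    [d] in [P], some powers of which lie in [QS] locally at [P]; this makes the
    Koszul complex on the generators of [QS] acyclic at [P]. *)
Lemma ext_quasi_regular d (a : d.-tuple R) t :
  (forall P : set S, maximal_ideal P -> height P d) ->
  [set` a] `<=` m -> ideal_exp m t `<=` ideal_gen [set` a] ->
  forall k (g : {mpoly S[d]}), form 0 k setT g ->
  ideal_exp (ideal_gen [set` map_tuple phi a]) k.+1 g.@[tnth (map_tuple phi a)] ->
  forall b, ideal_gen [set` map_tuple phi a] g@_b.
Proof.
move=> htd am mQ k g fg H b; have [noethS depthS] := CM.
apply: (quasi_regular _ fg H) => j x ltj.
apply: kos_exact_drop_regular; rewrite ?size_map ?size_tuple //.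
  by move=> P z mP /mapP[y ya ->]; apply: maximal_lies_over => //; exact: am.
apply: kos_exact_of_local => P mP.
have [n [htP [[y [regy yP sizey] _]]]] := depthS P mP.
have En : n = d by apply: max_chain_uniq htP (htd P mP).
apply: (kos_acyclic_regular (maximal_ideal_prime mP) regy) => //.
  by rewrite size_map size_tuple sizey En.
move=> i lti; have Py : P y`_i by apply: yP => /=; exact: mem_nth.
have [s0 [q [Ps0 E]]] := parameter_power (ideal_gen_ideal _) mQ mP Py.
by exists s0, q; split=> //; rewrite -ideal_ext_gen.
Qed.

Lemma meval_map d (F : {mpoly R[d]}) (a : d.-tuple R) :
  (map_mpoly phi F).@[tnth (map_tuple phi a)] = phi F.@[tnth a].
Proof.
pose k := maxn (msize (map_mpoly phi F)) (msize F).
rewrite /meval (@mmapE _ _ _ _ _ _ k) ?leq_maxl // (@mmapE _ _ _ _ _ _ k) ?leq_maxr // rmorph_sum.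
apply: eq_bigr => b _; rewrite /= mcoeff_map_mpoly rmorphM /mmap1 rmorph_prod.
by congr (_ * _); apply: eq_bigr => i _; rewrite tnth_map rmorphXn.
Qed.

(** The form kills the Sally module of [K], and therefore maps [K^(n+1)S] into
    [K Q^(n+e) S]; since [QS] is generated by a quasi-regular sequence, it can be
    cancelled. *)
Lemma sally_ext_zero d (a : d.-tuple R) t e (K : set R) (F : {mpoly R[d]}) :
  (forall P : set S, maximal_ideal P -> height P d) ->
  let Q := ideal_gen [set` a] in
  ideal K -> Q `<=` K -> Q `<=` m -> ideal_exp m t `<=` Q ->
  form 0 e setT F -> (exists b, ~ m F@_b) ->
  (forall n x, (1 <= n)%N -> ideal_exp K n.+1 x ->
     ideal_mul K (ideal_exp Q (n + e)) (F.@[tnth a] * x)) ->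
  sally_zero (ideal_ext phi K) (ideal_ext phi Q).
Proof.
move=> htd Q iK QK Qm mQ fF nF FK.
have im := local_ideal localm.
have [|b0 [nb0 maxb0]] := mpoly_max (g := F) _ nF.
  by move=> b; apply: contra_notN => /eqP ->; exact: ideal0.
have [u uE] := local_unit localm nb0.
have fE b : (map_mpoly phi F)@_b = phi F@_b by rewrite mcoeff_map_mpoly.
have am : [set` a] `<=` m by apply: subset_trans Qm; exact: sub_ideal_gen.
have QE : ideal_ext phi Q = ideal_gen [set` map_tuple phi a] by rewrite ideal_ext_gen.
have iEK := ideal_ext_ideal phi K.
move=> p [p0 Hp]; split=> // n n1; rewrite QE.
apply: (@quasi_regular_cancel S d (map_mpoly phi F) (ideal_ext phi m) b0 (phi u)
          _ _ (map_tuple phi a) e _ _ _ t) => //.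
- by rewrite fE -rmorphM uE rmorph1.
- move=> b lt; rewrite fE; apply: mem_ideal_ext; apply: contrapT => /maxb0.
  by rewrite leNgt lt.
- move=> b; rewrite fE; split=> // nz; have [_] := fF b; apply.
  by apply: contra_neq nz => ->; rewrite rmorph0.
- exact: ext_quasi_regular htd am mQ.
- by rewrite -QE; exact: ideal_extS.
- by rewrite -QE -ideal_ext_exp; exact: ideal_extS.
rewrite -QE -ideal_ext_exp -ideal_ext_mul meval_map.
have := Hp n n1; rewrite -ideal_ext_exp => Kp.
have iE := ideal_ext_ideal phi (ideal_mul K (ideal_exp Q (n + e))).
suff : ideal_ext phi (ideal_exp K n.+1) `<=`
    [set z | ideal_ext phi (ideal_mul K (ideal_exp Q (n + e))) (phi F.@[tnth a] * z)] by exact.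
apply: ideal_ext_min => [|x Kx /=].
  split; rewrite /=; first by rewrite mulr0; exact: (ideal0 iE).
    by move=> v w Ev Ew; rewrite mulrDr; exact: (idealD iE Ev Ew).
  by move=> c v Ev; rewrite -[c *: v]/(c * v) mulrCA; exact: (idealM _ iE Ev).
by rewrite -rmorphM; apply: mem_ideal_ext; exact: FK.
Qed.

End FiniteMorphism.

(** * Presenting the Rees algebra by polynomials *)

Section ReesPresentation.
Local Open Scope classical_set_scope.
Variables (R : comNzRingType) (d : nat) (a : d.-tuple R).
Let Q := ideal_gen [set` a].

Definition rees_map (G : {mpoly R[d]}) : {poly R} :=
  mmap (@polyC R) (fun i => tnth a i *: 'X) G.

Lemma rees_mapD G H : rees_map (G + H) = rees_map G + rees_map H.
Proof. exact: mmapD. Qed.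

Lemma rees_mapB G H : rees_map (G - H) = rees_map G - rees_map H.
Proof. exact: mmapB. Qed.

Lemma rees_mapM G H : rees_map (G * H) = rees_map G * rees_map H.
Proof. exact: rmorphM. Qed.

Lemma rees_map1 : rees_map 1 = 1.
Proof. exact: rmorph1. Qed.

Lemma rees_map0 : rees_map 0 = 0.
Proof. exact: mmap0. Qed.

Lemma rees_mapC c : rees_map c%:MP = c%:P.
Proof. exact: mmapC. Qed.

Definition homog_part e (G : {mpoly R[d]}) : {mpoly R[d]} :=
  \sum_(b <- msupp G | mdeg b == e) G@_b *: 'X_[b].

Lemma homog_part_coef e G b :
  (homog_part e G)@_b = if mdeg b == e then G@_b else 0.
Proof.
rewrite raddf_sum /= (eq_bigr (fun c => if c == b then G@_b else 0)); last first.
  move=> c _; rewrite mcoeffZ mcoeffX; case: eqP => [->|]; rewrite ?mulr1 ?mulr0 //.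
case: ifP => [bE|bE]; last first.
  by rewrite big1 // => c cE; case: eqP => // cb; rewrite -cb cE in bE.
have [bG|nbG] := boolP (b \in msupp G); last first.
  by rewrite memN_msupp_eq0 // big1 // => c _; case: eqP.
rewrite big_mkcond (bigD1_seq b) ?msupp_uniq //= bE eqxx big1 ?addr0 // => c /negPf ->.
by case: ifP.
Qed.

Lemma homog_part_form e G : form 0 e setT (homog_part e G).
Proof.
by move=> b; split=> //; rewrite homog_part_coef free_below0; case: ifP => // _; rewrite eqxx.
Qed.

Lemma rees_map_coef G e : (rees_map G)`_e = (homog_part e G).@[tnth a].
Proof.
have monoE b : mmap1 (fun i => tnth a i *: 'X) b = mmap1 (tnth a) b *: 'X^(mdeg b).
  rewrite /mmap1 mdegE; elim/big_rec3: _ => [|i x y z _ ->]; first by rewrite expr0 scale1r.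
  by rewrite exprZn -scalerAl -scalerAr scalerA exprD.
rewrite /rees_map /mmap coef_sum raddf_sum [RHS]big_mkcond /=.
apply: eq_bigr => b _; rewrite monoE mul_polyC scalerA coefZ coefXn mevalZ mevalX eq_sym.
by case: eqP => _; rewrite ?mulr1 ?mulr0.
Qed.

Lemma rees_map_in G : rees_map G \in rees_pred Q.
Proof.
apply/asboolP => e; rewrite rees_map_coef.
have := ideal_exp_formE a 0 e; rewrite drop0 => ->.
by exists (homog_part e G) => //; exact: homog_part_form.
Qed.

Lemma rees_map_form e G : form 0 e setT G -> rees_map G = G.@[tnth a] *: 'X^e.
Proof.
move=> fG; apply/polyP => k; rewrite rees_map_coef coefZ coefXn.
have [->|ne] := eqVneq k e.
  rewrite mulr1; congr (_.@[_]); apply/mpolyP => b; rewrite homog_part_coef.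
  by case: ifP => // bE; rewrite (form_coef0 fG) // bE.
rewrite mulr0 -[RHS](meval0 (tnth a)); congr (_.@[_]); apply/mpolyP => b.
rewrite homog_part_coef mcoeff0; case: ifP => // /eqP bE.
by rewrite (form_coef0 fG) // bE (negPf ne).
Qed.

Lemma rees_map_surj (x : rees Q) : exists G, rees_map G = val x.
Proof.
have /asboolP xQ := valP x.
have ex e : exists G, rees_map G = (val x)`_e *: 'X^e.
  have := xQ e; have := ideal_exp_formE a 0 e; rewrite drop0 => -> [G fG <-].
  by exists G; exact: rees_map_form.
pose G e := projT1 (cid (ex e)).
exists (\sum_(e < size (val x)) G e).
rewrite (big_morph _ rees_mapD rees_map0) -[RHS]coefK poly_def.
by apply: eq_bigr => e _; rewrite /G; case: cid.
Qed.

(** * Forms annihilating the Sally module *)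

Variable m : set R.
Hypothesis localm : local_ring m.
Variable K : set R.

Definition sally_kills e (c : R) : Prop := forall n x, (1 <= n)%N ->
  ideal_exp K n.+1 x -> ideal_mul K (ideal_exp Q (n + e)) (c * x).

Let module := restr (rees_incl Q).

Let sally_ann : set (rees Q) :=
  @quot_ann (rees Q) module (sally_num K) (sally_den K Q).

Lemma sally_ann_coef (g : rees Q) e : sally_ann g -> sally_kills e (val g)`_e.
Proof.
move=> Ag n x n1 Kx.
have [|_] := Ag (x *: 'X^n : {poly R}).
  split; first by rewrite coefZ coefXn eq_sym; case: n n1 {Kx} => // n _; rewrite mulr0.
  move=> k k1; rewrite coefZ coefXn; have [->|_] := eqVneq k n; first by rewrite mulr1.
  by rewrite mulr0; apply: ideal0; exact: ideal_exp_ideal.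
move/(_ (n + e)%N); rewrite addn_gt0 n1 => /(_ isT).
suff -> : (g *: (x *: 'X^n : module) : {poly R})`_(n + e) = (val g)`_e * x by [].
rewrite -[_ *: _]/(val g * (x *: 'X^n)) -scalerAr coefZ coefMXn ltnNge leq_addr /=.
by rewrite addKn mulrC.
Qed.

(** If every form annihilating the Sally module has its coefficients in [m], then
    so does the kernel of the presentation, and the ideals generated by [m] and
    the first [i] variables descend to a chain of primes above the annihilator. *)
Lemma sally_chain_or_form :
  has_chain (quot_support_primes (sally_num K : set module) (sally_den K Q)) d \/
  exists e F, [/\ form 0 e setT F, exists b, ~ m F@_b & sally_kills e F.@[tnth a]].
Proof.
have [ex|nex] := pselect (exists e F,
  [/\ form 0 e setT F, exists b, ~ m F@_b & sally_kills e F.@[tnth a]]); first by right.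
left; have [im m1 pm] := local_prime localm.
have killm G : (forall e, sally_kills e (rees_map G)`_e) -> forall b, m G@_b.
  move=> kG b; apply: contrapT => nm; apply: nex; exists (mdeg b), (homog_part (mdeg b) G).
  split; first exact: homog_part_form.
    by exists b; rewrite homog_part_coef eqxx.
  by rewrite -rees_map_coef.
have kerm G : rees_map G = 0 -> forall b, m G@_b.
  move=> G0; apply: killm => e n x n1 _; rewrite G0 coef0 mul0r.
  by apply: ideal0; exact: ideal_mul_ideal.
have eqm G H b : rees_map G = rees_map H -> m H@_b -> m G@_b.
  move=> E mH; rewrite -(subrK H@_b G@_b); apply: (idealD im) => //.
  by rewrite -mcoeffB; apply: kerm; rewrite rees_mapB E subrr.
pose V i (G : {mpoly R[d]}) := forall b, free_below i b -> m G@_b.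
pose P i : set (rees Q) := [set g | exists2 G, rees_map G = val g & V i G].
have VM i C G : V i G -> V i (C * G).
  move=> VG b fb; rewrite mcoeffM; apply: ideal_sum => // -[b1 b2] /= /eqP bE.
  apply: idealM => //; apply: VG.
  by have := congr1 (free_below i) bE; rewrite fb free_belowD => /esym /andP[].
have valPE i (g : rees Q) G : rees_map G = val g -> P i g -> V i G.
  by move=> GE [H HE VH] b fb; apply: eqm (VH b fb); rewrite GE HE.
exists P; split=> i lei.
  split.
    split.
    - split; first by exists 0; [exact: rees_map0 | move=> b _; rewrite mcoeff0; exact: ideal0].
        move=> x y [G GE VG] [H HE VH]; exists (G + H); first by rewrite rees_mapD GE HE.
        by move=> b fb; rewrite mcoeffD; apply: idealD; [|exact: VG | exact: VH].
      move=> c x [G GE VG]; have [C CE] := rees_map_surj c.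
      by exists (C * G); [rewrite rees_mapM CE GE | exact: VM].
    - have v1 : rees_map 1 = val (1 : rees Q).
        by rewrite rees_map1; exact: esym (rmorph1 (rees_incl Q)).
      move=> /(valPE _ _ _ v1) /(_ 0%MM); rewrite mcoeff1 eqxx => H; apply: m1; apply: H.
      by apply/free_belowP => k _; rewrite mnm0E.
    - move=> x y Pxy; have [X XE] := rees_map_surj x; have [Y YE] := rees_map_surj y.
      have VXY : V i (X * Y) by apply: valPE Pxy; rewrite rees_mapM XE YE.
      apply: contrapT => nP.
      have [b [[fb nb] maxb]] : exists b, (free_below i b /\ ~ m X@_b) /\
          forall b', free_below i b' /\ ~ m X@_b' -> (b' <= b)%O.
        apply: (mpoly_max (g := X) (P := fun b => free_below i b /\ ~ m X@_b)).
          by move=> b [_]; apply: contra_notN => /eqP ->; exact: ideal0.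
        apply: contrapT => nb; apply: nP; left; exists X => // b fb.
        by apply: contrapT => nm; apply: nb; exists b.
      have [c [[fc nc] maxc]] : exists b, (free_below i b /\ ~ m Y@_b) /\
          forall b', free_below i b' /\ ~ m Y@_b' -> (b' <= b)%O.
        apply: (mpoly_max (g := Y) (P := fun b => free_below i b /\ ~ m Y@_b)).
          by move=> c [_]; apply: contra_notN => /eqP ->; exact: ideal0.
        apply: contrapT => nc; apply: nP; right; exists Y => // c fc.
        by apply: contrapT => nm; apply: nc; exists c.
      have fbc : free_below i (b + c)%MM by rewrite free_belowD fb fc.
      have : m (X@_b * Y@_c).
        rewrite -[_ * _](subKr (X * Y)@_(b + c)); apply: (idealB im); first exact: VXY.
        apply: mcoeffM_lead => // b' c' E lt; move: fbc; rewrite -E free_belowD => /andP[fb' fc'].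
          apply: (idealMr _ im); apply: contrapT => nm.
          by have := maxb b' (conj fb' nm); rewrite leNgt lt.
        apply: (idealM _ im); apply: contrapT => nm.
        by have := maxc c' (conj fc' nm); rewrite leNgt lt.
      by move/pm => [].
  move=> g Ag; have [G GE] := rees_map_surj g; exists G => // b _.
  by apply: killm => e; rewrite GE; exact: sally_ann_coef.
have lemP (b : 'X_{1..d}) : free_below i.+1 b -> free_below i b.
  by move=> /free_belowP fb; apply/free_belowP => k lt; apply: fb; exact: ltnW.
split=> [g [G GE VG]|le]; first by exists G => // b /lemP; exact: VG.
pose x : rees Q := Rees (rees_map_in 'X_(Ordinal lei)).
have /le Px : P i.+1 x.
  exists 'X_(Ordinal lei) => // b /free_belowP fb; rewrite mcoeffX.
  case: eqP => [bE|_]; last exact: ideal0.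
  by have := fb (Ordinal lei) (leqnn _); rewrite -bE mnm1E eqxx.
have := valPE i x _ (erefl _) Px U_(Ordinal lei)%MM; rewrite mcoeffX eqxx => H; apply: m1.
apply: H; apply/free_belowP => k lt; rewrite mnm1E; case: eqP => // kE.
by rewrite -kE /= ltnn in lt.
Qed.

End ReesPresentation.

(** * Chains of primes and algebraic relations *)

Section PrimeChain.
Local Open Scope classical_set_scope.
Variables (A : comNzRingType) (n N : nat) (P : nat -> set A) (x : 'I_n -> A).
Hypotheses (primeP : forall i, (i <= n)%N -> prime_ideal (P i))
  (leP : forall i, (i < n)%N -> P i `<=` P i.+1)
  (xP : forall i : 'I_n, P i.+1 (x i)) (nxP : forall i : 'I_n, ~ P i (x i)).

(** One variable after the other, the least power of [x_j] can be divided out and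
    the terms still divisible by [x_j] vanish in the next prime; a single
    coefficient survives. *)
Lemma prime_chain_relation (c : {ffun 'I_n -> 'I_N} -> A)
    (G : {set {ffun 'I_n -> 'I_N}}) :
  G != finset.set0 -> P 0%N (\sum_(g in G) c g * \prod_i x i ^+ g i) ->
  exists2 g, g \in G & P n (c g).
Proof.
move=> G0 PG.
suff H j : (j <= n)%N -> exists G' : {set {ffun 'I_n -> 'I_N}},
    [/\ G' != finset.set0, {subset G' <= G},
        forall g g' (i : 'I_n), g \in G' -> g' \in G' -> (i < j)%N -> g i = g' i
      & P j (\sum_(g in G') c g * \prod_(i < n | (j <= i)%N) x i ^+ g i)].
  have [G' [/finset.set0Pn [g gG'] sG' eqG' PG']] := H n (leqnn n).
  exists g; first exact: sG'.
  suff E : G' = [set g]%SET.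
    move: PG'; rewrite E finset.big_set1 big1 ?mulr1 // => i.
    by rewrite leqNgt ltn_ord.
  apply/finset.setP => g'; rewrite finset.in_set1; apply/idP/eqP => [g'G'|-> //].
  by apply/ffunP => i; apply: eqG' => //; exact: ltn_ord.
elim: j => [_|j IH ltj].
  by exists G; split=> // g g' i; rewrite ltn0.
have [G' [/finset.set0Pn [g0 g0G'] sG' eqG' PG']] := IH (ltnW ltj).
pose i0 := Ordinal ltj.
case: (arg_minnP (fun g : {ffun 'I_n -> 'I_N} => nat_of_ord (g i0)) g0G') => g1 g1G min1.
have g1G' : g1 \in G' := g1G.
set e := nat_of_ord (g1 i0) in min1.
pose G2 := [set g in G' | nat_of_ord (g i0) == e]%SET.
have sG2 g : g \in G2 -> g \in G' by rewrite finset.inE => /andP[].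
exists G2; split.
- by apply/finset.set0Pn; exists g1; rewrite finset.inE g1G' eqxx.
- by move=> g /sG2 /sG'.
- move=> g g' i gG2 g'G2; rewrite ltnS leq_eqVlt => /predU1P[ij|].
    have -> : i = i0 by exact: val_inj.
    apply: val_inj; move: gG2 g'G2; rewrite !finset.inE /=.
    by move=> /andP[_ /eqP ->] /andP[_ /eqP ->].
  by apply: eqG'; exact: sG2.
pose tail g := c g * \prod_(i < n | (j.+1 <= i)%N) x i ^+ g i.
pose S1 := \sum_(g in G2) tail g.
pose S2 := \sum_(g in G' | g \notin G2) tail g * x i0 ^+ (g i0 - e).-1.
have sumE : \sum_(g in G') c g * \prod_(i < n | (j <= i)%N) x i ^+ g i =
    x i0 ^+ e * (S1 + x i0 * S2).
  have termE g : g \in G' -> c g * \prod_(i < n | (j <= i)%N) x i ^+ g i =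
      x i0 ^+ e * (tail g * x i0 ^+ (g i0 - e)).
    move=> gG'; rewrite (bigD1 i0) //= (eq_bigl (fun i : 'I_n => (j.+1 <= i)%N)); last first.
      by move=> i; rewrite [RHS]ltn_neqAle andbC -val_eqE eq_sym.
    by rewrite -{1}(subnKC (min1 g gG')) exprD /tail; ring.
  rewrite (eq_bigr _ termE) -mulr_sumr; congr (_ * _).
  rewrite (bigID (fun g => g \in G2)) /=; congr (_ + _).
    rewrite (eq_bigl (fun g => g \in G2)); last first.
      by move=> g; rewrite andb_idl //; exact: sG2.
    by apply: eq_bigr => g; rewrite finset.inE => /andP[_ /eqP ->]; rewrite subnn mulr1.
  rewrite mulr_sumr; apply: eq_bigr => g /andP[gG']; rewrite finset.inE gG' /= => ne.
  have lt : (0 < g i0 - e)%N by rewrite subn_gt0 ltn_neqAle eq_sym ne min1.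
  by rewrite -{1}(prednK lt) exprS; ring.
have [iPj _ pPj] := primeP (ltnW ltj); have [iPj1 _ _] := primeP ltj.
move: PG'; rewrite sumE => /pPj [|/(leP ltj) PS].
  move/(prime_idealX (primeP (ltnW ltj))) => H; by have := @nxP i0 H.
rewrite -[X in P _ X](addrK (x i0 * S2)); apply: (idealB iPj1) => //.
by apply: (idealMr _ iPj1); exact: (xP i0).
Qed.

End PrimeChain.

(** * The dimension of the Sally module *)

Section ReductionPowers.
Local Open Scope classical_set_scope.
Variables (R : comNzRingType) (K Q : set R) (r : nat).
Hypothesis iK : ideal K.
Hypothesis red : ideal_exp K r.+1 = ideal_mul Q (ideal_exp K r).

Lemma reduction_power n :
  ideal_exp K (r.+1 + n) `<=` ideal_mul (ideal_exp K r.+1) (ideal_exp Q n).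
Proof.
elim: n => [|n IH].
  rewrite addn0 => x Kx; rewrite -[x]mulr1; exact: mem_ideal_mul.
have iM := ideal_mul_ideal (ideal_exp K r.+1) (ideal_exp Q n.+1).
apply: subset_trans (_ : ideal_mul K (ideal_exp K (r.+1 + n)) `<=` _).
  by rewrite addnS.
apply: ideal_mul_min => // x y Kx /IH.
suff : ideal_mul (ideal_exp K r.+1) (ideal_exp Q n) `<=`
    [set y | ideal_mul (ideal_exp K r.+1) (ideal_exp Q n.+1) (x * y)] by exact.
apply: ideal_mul_min.
  split; rewrite /=; first by rewrite mulr0; exact: (ideal0 iM).
    by move=> v w Ev Ew; rewrite mulrDr; exact: (idealD iM Ev Ew).
  by move=> c v Ev; rewrite -[c *: v]/(c * v) mulrCA; exact: (idealM _ iM Ev).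
move=> u v; rewrite red => Qu Qv /=; rewrite mulrA.
have : ideal_mul Q (ideal_exp K r.+1) (x * u).
  move: Qu; suff : ideal_mul Q (ideal_exp K r) `<=`
      [set u | ideal_mul Q (ideal_exp K r.+1) (x * u)] by exact.
  have iM' := ideal_mul_ideal Q (ideal_exp K r.+1).
  apply: ideal_mul_min.
    split; rewrite /=; first by rewrite mulr0; exact: (ideal0 iM').
      by move=> z w Ev Ew; rewrite mulrDr; exact: (idealD iM' Ev Ew).
    by move=> c z Ev; rewrite -[c *: z]/(c * z) mulrCA; exact: (idealM _ iM' Ev).
  move=> z w Qz Kw /=; rewrite mulrCA; apply: mem_ideal_mul => //.
  exact: mem_ideal_mul Kx Kw.
suff : ideal_mul Q (ideal_exp K r.+1) `<=`
    [set s | ideal_mul (ideal_exp K r.+1) (ideal_exp Q n.+1) (s * v)].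
  by rewrite -red => H /H.
apply: ideal_mul_min.
  split; rewrite /=; first by rewrite mul0r; exact: (ideal0 iM).
    by move=> z w Ev Ew; rewrite mulrDl; exact: (idealD iM Ev Ew).
  by move=> c z Ev; rewrite -[c *: z]/(c * z) -mulrA; exact: (idealM _ iM Ev).
move=> z w Qz Kw /=; rewrite mulrAC mulrC; apply: mem_ideal_mul => //.
exact: mem_ideal_mul Qz Qv.
Qed.

(** A power of [K] kills the whole Sally module, because [K^(r+1+n)] lies in
    [K Q^n]. *)
Lemma reduction_annihilates n c x : ideal_exp K r c -> ideal_exp K n.+1 x ->
  ideal_mul K (ideal_exp Q n) (c * x).
Proof.
move=> Kc Kx.
have : ideal_exp K (r.+1 + n) (c * x) by rewrite addSnnS; exact: ideal_exp_mul.
move/reduction_power; apply: ideal_mulS => //.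
exact: ideal_mul_subl.
Qed.

End ReductionPowers.

Section SallyDimension.
Local Open Scope classical_set_scope.
Variables (R : comNzRingType) (m : set R) (d : nat) (a : d.-tuple R) (K : set R) (r : nat).
Let Q := ideal_gen [set` a].
Hypotheses (localm : local_ring m) (iK : ideal K).
Hypothesis red : ideal_exp K r.+1 = ideal_mul Q (ideal_exp K r).
Hypothesis mK : m `<=` radical K.

Let module := restr (rees_incl Q).
Definition rees_el (G : {mpoly R[d]}) : rees Q := Rees (rees_map_in a G).

Lemma rees_elD G H : rees_el (G + H) = rees_el G + rees_el H.
Proof. by apply: val_inj; rewrite /= rees_mapD. Qed.

Lemma rees_elM G H : rees_el (G * H) = rees_el G * rees_el H.
Proof. by apply: val_inj; rewrite /= rees_mapM. Qed.

Lemma rees_el0 : rees_el 0 = 0.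
Proof. by apply: val_inj; rewrite /= rees_map0. Qed.

Lemma rees_el1 : rees_el 1 = 1.
Proof. by apply: val_inj; rewrite /= rees_map1. Qed.

Lemma rees_elX G k : rees_el (G ^+ k) = rees_el G ^+ k.
Proof. by elim: k => [|k IH]; rewrite ?expr0 ?rees_el1 // !exprS rees_elM IH. Qed.

(** The constants from [m] act nilpotently on the Sally module. *)
Lemma support_const (P : set (rees Q)) c :
  quot_support_primes (sally_num K : set module) (sally_den K Q) P -> m c ->
  P (rees_el c%:MP).
Proof.
move=> [pP annP] /mK [k Kc]; apply: (prime_idealX (n := k * r) pP).
apply: annP => p [p0 Hp]; rewrite -rees_elX.
have E (n : nat) : (rees_el (c%:MP ^+ (k * r)) *: (p : module) : {poly R})`_n = c ^+ (k * r) * p`_n.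
  by rewrite -[_ *: _]/(rees_map a (c%:MP ^+ (k * r)) * p) -rmorphXn /= rees_mapC coefCM.
split=> [|n n1]; first by rewrite E p0 mulr0.
rewrite E; apply: (reduction_annihilates iK red) => //; last exact: Hp.
by rewrite exprM; have [//|] := ideal_expX r r Kc; rewrite ltnn.
Qed.

(** [d + 1] elements separating the members of a longer chain would satisfy a
    nontrivial relation over the residue field, since there are more monomials in
    them of bounded exponents than monomials in [d] variables that can occur. *)
Lemma sally_dim_bound :
  ~ has_chain (quot_support_primes (sally_num K : set module) (sally_den K Q)) d.+1.
Proof.
move=> [P [suppP ltP]]; have [im m1 _] := local_prime localm.
have ex (i : 'I_d.+1) : exists g : rees Q, P i.+1 g /\ ~ P i g.
  have [_ nle] := ltP i (ltn_ord i); apply: contrapT => H; apply: nle => g Pg.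
  by apply: contrapT => nPg; apply: H; exists g.
pose x i := projT1 (cid (ex i)); have xP (i : 'I_d.+1) : P i.+1 (x i) /\ ~ P i (x i) := projT2 (cid (ex i)).
have exG i : exists G, rees_el G = x i.
  by have [G GE] := rees_map_surj (x i); exists G; apply: val_inj.
pose G i := projT1 (cid (exG i)); have GE i : rees_el (G i) = x i := projT2 (cid (exG i)).
(* The products [mon g] with exponents below [N] have degrees below [B = E N].
   There are [N ^ (d + 1)] of them but only [B ^ d] monomials that can occur, and
   [N] exceeds [E ^ d]. *)
pose D := (\max_i msize (G i)).+1.
pose E := (d.+1 * (D + 3))%N; pose N := (E ^ d).+1; pose B := (E * N)%N.
pose T := {ffun 'I_d.+1 -> 'I_N}; pose U := {ffun 'I_d -> 'I_B}.
pose mon (g : T) := \prod_i G i ^+ g i.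
have degX (F : {mpoly R[d]}) k : (msize (F ^+ k) <= (k * (msize F).+1).+1)%N.
  elim: k => [|k IH]; first by rewrite expr0 msize1.
  rewrite exprS; apply: leq_trans (msizeM_le _ _) _.
  by rewrite mulSn; move: IH; lia.
have degmon g : (msize (mon g) <= B)%N.
  have [L LE] : exists L, L = (N.-1 * D + 2)%N by eexists.
  have H (s : seq 'I_d.+1) : (msize (\prod_(i <- s) G i ^+ g i) <= (size s * L).+1)%N.
    elim: s => [|i s IH]; first by rewrite big_nil msize1.
    rewrite big_cons; apply: leq_trans (msizeM_le _ _) _.
    have le1 : (msize (G i ^+ g i) < L)%N.
      rewrite LE addn2 ltnS; apply: leq_trans (degX _ _) _; rewrite ltnS.
      apply: leq_mul; first by rewrite -ltnS ltn_ord.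
      by rewrite /D ltnS (leq_bigmax i).
    rewrite /= mulSn; move: IH le1.
    move: (msize (G i ^+ g i)) (msize (\prod_(k <- s) _)) (size s * L)%N => u v w; lia.
  apply: leq_trans (H _) _.
  have -> : size (index_enum 'I_d.+1) = d.+1 by rewrite /index_enum -enumT size_enum_ord.
  rewrite /B /E -mulnA; apply: (@leq_trans (d.+1 * (N.-1 * D + 3))%N).
    by rewrite LE; lia.
  rewrite leq_mul2l /= /N /=; move: (E ^ d)%N => M; rewrite mulnS mulnDl; lia.
pose Mx (g : T) (u : U) := (mon g)@_[multinom (u i : nat) | i < d].
have [|c [[g1 _ c1] c2]] := @local_dependence R m localm T U Mx [set: T]%SET [set: U]%SET.
  rewrite !finset.cardsT !card_ffun !card_ord /B expnMn expnS.
  by rewrite ltn_mul2r expn_gt0 /= /N ltnS leqnn.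
pose H := \sum_g c g *: mon g.
have Hm b : m H@_b.
  have [lt|ge] := ltnP (mdeg b) B; last first.
    rewrite raddf_sum big1 => [|g _]; first exact: ideal0.
    rewrite /= mcoeffZ memN_msupp_eq0 ?mulr0 //; apply/negP => /msize_mdeg_lt.
    by rewrite ltnNge (leq_trans (degmon g) ge).
  have ltb i : (b i < B)%N.
    by apply: leq_ltn_trans lt; rewrite mdegE (bigD1 i) //= leq_addr.
  have -> : b = [multinom (([ffun i => Ordinal (ltb i)] : U) i : nat) | i < d].
    by apply/mnmP => i; rewrite mnmE ffunE.
  have := c2 [ffun i => Ordinal (ltb i)]; rewrite finset.in_setT => /(_ isT).
  rewrite raddf_sum; congr m; apply: eq_big => [g|g _]; first by rewrite finset.in_setT.
  by rewrite /= mcoeffZ.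
have iP i : (i <= d.+1)%N -> ideal (P i) by move=> /suppP [[]].
have P0H F : (forall b, m F@_b) -> P 0%N (rees_el F).
  move=> mF; rewrite [F]mpolyE (big_morph _ rees_elD rees_el0).
  apply: ideal_sum => [|b _]; first exact: iP.
  rewrite -mul_mpolyC rees_elM; apply: (idealMr _ (iP _ _)) => //.
  by apply: support_const => //; exact: suppP.
pose cc g := rees_el (c g)%:MP.
pose Gam := [set g : T | `[< ~ m (c g) >]]%SET.
have [||||||g gG Pg] := @prime_chain_relation (rees Q) d.+1 N P x _ _ _ _ cc Gam.
- by move=> i /suppP [].
- by move=> i /ltP [].
- by move=> i; case: (xP i).
- by move=> i; case: (xP i).
- by apply/finset.set0Pn; exists g1; rewrite finset.inE; exact/asboolP.
- have termE g : cc g * \prod_i x i ^+ g i = rees_el (c g *: mon g).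
    rewrite -mul_mpolyC rees_elM; congr (_ * _).
    rewrite /mon (big_morph _ rees_elM rees_el1); apply: eq_bigr => i _.
    by rewrite rees_elX GE.
  rewrite (eq_bigr _ (fun g _ => termE g)) -(big_morph _ rees_elD rees_el0).
  apply: P0H => b.
  have -> : \sum_(g in Gam) c g *: mon g = H - \sum_(g | g \notin Gam) c g *: mon g.
    by apply/eqP; rewrite eq_sym subr_eq /H (bigID (mem Gam)).
  rewrite mcoeffB; apply: (idealB im) => //; rewrite raddf_sum.
  apply: ideal_sum => // g; rewrite finset.inE => /asboolPn /contrapT mc.
  by rewrite /= mcoeffZ; exact: idealMr.
have nc : ~ m (c g) by move: gG; rewrite finset.inE => /asboolP.
have [u uE] := local_unit localm nc.
have [[iPd Pd1 _] _] := suppP d.+1 (leqnn _); apply: Pd1.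
rewrite -rees_el1 -[1]/(1%:MP) -uE mpolyCM rees_elM.
exact: idealM.
Qed.

End SallyDimension.

(** * Growth of the Sally module *)

Lemma card_ord_lt n c : (#|[pred x : 'I_n | (x < c)%N]| <= c)%N.
Proof.
rewrite -sum1_card big_mkcond /=.
suff : (\sum_(i < n) (if (i < c)%N then 1 else 0) <= minn n c)%N.
  by move/leq_trans; apply; exact: geq_minr.
elim: n => [|n IH]; first by rewrite big_ord0.
by rewrite big_ord_recr /=; apply: leq_trans (leq_add IH (leqnn _)) _; case: ifP => lt; lia.
Qed.

Section CountMonomials.
Variables (d N : nat) (b0 : 'X_{1..d}).

Definition box_mon (f : {ffun 'I_d -> 'I_N.+1}) : 'X_{1..d} :=
  [multinom (f i : nat) | i < d].

Definition undivided (k : nat) : {set {ffun 'I_d -> 'I_N.+1}} :=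
  [set f | (mdeg (box_mon f) == k) && ~~ (b0 <= box_mon f)%MM].

(** A monomial that [b0] does not divide has one of its [d] exponents below that
    of [b0], which leaves [d - 1] free exponents. *)
Lemma sum_card_undivided :
  (\sum_(k < N.+1) #|undivided k| <= mdeg b0 * N.+1 ^ d.-1)%N.
Proof.
pose slab (i : 'I_d) := [set f : {ffun 'I_d -> 'I_N.+1} | (f i < b0 i)%N].
apply: (@leq_trans #|\bigcup_i slab i|).
  have E k : #|undivided k| =
      (\sum_(f | ~~ (b0 <= box_mon f)%MM) (mdeg (box_mon f) == k))%N.
    rewrite -sum1_card [LHS]big_mkcond [RHS]big_mkcond; apply: eq_bigr => f _.
    by rewrite inE; case: (mdeg _ == _); case: (_ <= _)%MM.
  rewrite (eq_bigr (fun k : 'I_N.+1 =>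
    (\sum_(f | ~~ (b0 <= box_mon f)%MM) (mdeg (box_mon f) == k))%N)); last first.
    by move=> k _; exact: E.
  rewrite exchange_big /= -sum1_card [leqRHS]big_mkcond [leqLHS]big_mkcond.
  apply: leq_sum => f _; case: ifP => // nle.
  have -> : f \in \bigcup_i slab i.
    have /existsP [i lt] : [exists i, (f i < b0 i)%N].
      apply: contraR nle => /existsPn H; apply/mnm_lepP => i.
      by rewrite mnmE leqNgt; exact: H.
    by apply/bigcupP; exists i => //; rewrite inE.
  have [ltk|lek] := ltnP (mdeg (box_mon f)) N.+1; last first.
    rewrite big1 // => k _; apply/eqP; rewrite eqb0; apply/eqP => kE.
    by move: lek; rewrite kE leqNgt ltn_ord.
  rewrite (bigD1 (Ordinal ltk)) //= eqxx big1 // => k ne.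
  by apply/eqP; rewrite eqb0 eq_sym; move: ne; rewrite -val_eqE.
have cardU : (#|\bigcup_i slab i| <= \sum_i #|slab i|)%N.
  elim/big_rec2: _ => [|i n A _ le]; first by rewrite cards0.
  by apply: leq_trans (leq_card_setU _ _) _; rewrite leq_add2l.
apply: leq_trans cardU _; rewrite mdegE big_distrl /=; apply: leq_sum => i _.
pose F (j : 'I_d) : pred 'I_N.+1 := fun x => (j == i) ==> (x < b0 i)%N.
have -> : #|slab i| = #|(family F : pred {ffun 'I_d -> 'I_N.+1})|.
  apply: eq_card => f; rewrite inE; apply/idP/familyP => [lt j|/(_ i)].
    by rewrite unfold_in; apply/implyP => /eqP ->.
  by rewrite unfold_in eqxx.
rewrite card_family foldrE big_map big_enum /= (bigD1 i) //=; apply: leq_mul.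
  have -> : #|F i| = #|[pred x : 'I_N.+1 | (x < b0 i)%N]|.
    by apply: eq_card => x; rewrite !unfold_in eqxx.
  exact: card_ord_lt.
rewrite (eq_bigr (fun=> N.+1)); last first.
  move=> j /negPf ji; rewrite -[RHS]card_ord; apply: eq_card => x.
  by rewrite unfold_in ji.
rewrite prod_nat_const; apply: leq_pexp2l => //.
by have := cardC1 i; rewrite card_ord => <-; apply: eq_leq; apply: eq_card.
Qed.

End CountMonomials.

Section Growth.
Local Open Scope classical_set_scope.
Variables (R : comNzRingType) (m : set R) (d : nat) (a : d.-tuple R) (K : set R) (r : nat).
Let Q := ideal_gen [set` a].
Hypotheses (noethR : noetherian R) (localm : local_ring m) (iK : ideal K) (QK : Q `<=` K).
Hypothesis r_pos : (0 < r)%N.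
Hypothesis red : ideal_exp K r.+1 = ideal_mul Q (ideal_exp K r).
Hypothesis mK : m `<=` radical K.

Lemma ideal_mul_genE (J : set R) (s : seq R) z : ideal J ->
  ideal_mul J (ideal_gen [set` s]) z ->
  exists c : nat -> R, (forall i, J (c i)) /\ z = \sum_(i < size s) c i * s`_i.
Proof.
move=> iJ; pose N := [set z | exists c : nat -> R,
  (forall i, J (c i)) /\ z = \sum_(i < size s) c i * s`_i].
suff sub : ideal_mul J (ideal_gen [set` s]) `<=` N by exact: sub.
apply: ideal_mul_min => [|x y Jx /ideal_genE [e ->]].
  split.
  - exists (fun=> 0); split; first by move=> _; exact: ideal0.
    by rewrite big1 // => i _; rewrite mul0r.
  - move=> _ _ [c [Jc ->]] [c' [Jc' ->]]; exists (fun i => c i + c' i); split.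
      by move=> i; exact: idealD.
    by rewrite -big_split; apply: eq_bigr => i _; rewrite mulrDl.
  - move=> b _ [c [Jc ->]]; exists (fun i => b * c i); split.
      by move=> i; exact: idealM.
    by rewrite -[_ *: _]/(b * _) mulr_sumr; apply: eq_bigr => i _; rewrite mulrA.
exists (fun i => x * (if insub i is Some j then e j else 0)); split.
  by move=> i; exact: idealMr.
by rewrite mulr_sumr; apply: eq_bigr => i _; rewrite valK mulrA.
Qed.

Lemma mmap1D (b c : 'X_{1..d}) :
  mmap1 (tnth a) (b + c)%MM = mmap1 (tnth a) b * mmap1 (tnth a) c.
Proof. by apply: commr_mmap1_M => i x; exact: mulrC. Qed.

Variables (e : nat) (F : {mpoly R[d]}).
Hypotheses (F_form : form 0 e setT F) (F_unit : exists b, ~ m F@_b).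
Hypothesis F_kills : sally_kills a K e F.@[tnth a].

Lemma maximal_ideal_rad c : m c -> exists u, u * (1 - c) = 1.
Proof.
have [im m1 _] := local_prime localm.
move=> mc; apply: (local_unit localm) => m1c; apply: m1.
by rewrite -(subrK c 1); exact: idealD.
Qed.

(** Modulo [m] the leading monomial of [F] can be rewritten into smaller ones, so
    by Nakayama's lemma the Sally module is generated in degree [r + k] by the
    products of the generators in degree [r] with the monomials not divisible by
    that leading monomial. *)
Lemma sally_growth : exists C E : nat, forall N, exists cnt : nat -> nat,
  (forall k, (k <= N)%N -> length_le (ideal_exp K (r + k).+1 : set R^o)
     (ideal_mul K (ideal_exp Q (r + k)) : set R^o) (cnt k * C)) /\
  (\sum_(k < N.+1) cnt k <= E * N.+1 ^ d.-1)%N.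
Proof.
have [im m1 _] := local_prime localm.
have [|b0 [nb0 maxb0]] := mpoly_max (g := F) _ F_unit.
  by move=> b; apply: contra_notN => /eqP ->; exact: ideal0.
have [u uE] := local_unit localm nb0.
have F0 : F@_b0 != 0 by apply/eqP => E; apply: nb0; rewrite E; exact: ideal0.
have b0e : mdeg b0 = e by have [_ /(_ F0) /andP[/eqP]] := F_form b0.
have [t mt] : exists t, ideal_exp m t `<=` ideal_exp K r.
  apply: radical_exp => // [|x /mK [n Kn]]; first exact: ideal_exp_ideal.
  by exists (n * r)%N; rewrite exprM; have [//|] := ideal_expX r r Kn; rewrite ltnn.
have [l hl] := quotient_length noethR localm mt.
have [s1 s1E] := noethR (ideal_exp_ideal K r.+1).
exists (size s1 * l)%N, (mdeg b0) => N.
exists (fun k => #|undivided N b0 k|); split; last exact: sum_card_undivided.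
move=> k lek; set n := (r + k)%N.
have [s2 s2E] := noethR (ideal_exp_ideal K n.+1).
pose good := [seq mmap1 (tnth a) (box_mon f) * g | f <- enum (undivided N b0 k), g <- s1].
have sizeG : size good = (#|undivided N b0 k| * size s1)%N.
  by rewrite size_allpairs cardE.
have iKQ := ideal_mul_ideal K (ideal_exp Q n).
have iK1 := ideal_exp_ideal K n.+1.
pose B : set R := [set x + y | x in ideal_gen [set` good] & y in ideal_mul K (ideal_exp Q n)].
have iB : ideal B by exact: (addset_submodule (ideal_gen_ideal _) iKQ).
have KQB : ideal_mul K (ideal_exp Q n) `<=` B.
  by move=> x Kx; exists 0; [exact: ideal0 (ideal_gen_ideal _) | exists x; rewrite ?add0r].
have goodB : [set` good] `<=` B.
  move=> x xg; exists x; first exact: sub_ideal_gen.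
  by exists 0; [exact: ideal0 | rewrite addr0].
have iZ := ideal_mul_ideal m (ideal_exp K n.+1).
pose W : set R := [set x + y | x in B & y in ideal_mul m (ideal_exp K n.+1)].
have iW : ideal W by exact: (addset_submodule iB iZ).
have BW : B `<=` W.
  by move=> x Bx; exists x => //; exists 0; [exact: ideal0 | rewrite addr0].
have ZW : ideal_mul m (ideal_exp K n.+1) `<=` W.
  by move=> x Zx; exists 0; [exact: ideal0 | exists x; rewrite ?add0r].
have monK b g j : mdeg b = j -> g \in s1 -> ideal_exp K (r + j).+1 (mmap1 (tnth a) b * g).
  move=> bj gs; rewrite -addSn mulrC; apply: ideal_exp_mul.
    by rewrite s1E; exact: sub_ideal_gen.
  apply: ideal_expS QK _ _; have := @ideal_exp_mmap1 _ _ a 0 j b bj (free_below0 b).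
  by rewrite drop0.
have monW b g : mdeg b = k -> g \in s1 -> W (mmap1 (tnth a) b * g).
  elim/(well_founded_induction (@ltom_wf d)): b => b IH bk gs.
  have [/submK bE|ndiv] := boolP (b0 <= b)%MM; last first.
    apply: BW; apply: goodB => /=; apply/allpairsP.
    have leb i : (b i < N.+1)%N.
      by rewrite ltnS; apply: leq_trans lek; rewrite -bk mdegE (bigD1 i) //= leq_addr.
    have fE : box_mon [ffun i => Ordinal (leb i)] = b.
      by apply/mnmP => i; rewrite mnmE ffunE.
    exists ([ffun i => Ordinal (leb i)], g); split=> //; last by rewrite /= fE.
    by rewrite mem_enum finset.inE fE bk eqxx.
  set c := (b - b0)%MM in bE; have cE : (mdeg c + e)%N = k by rewrite -b0e -mdegD bE.
  have Kc := monK c g (mdeg c) erefl gs.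
  have := F_kills (n := r + mdeg c) _ Kc; rewrite addn_gt0 r_pos => /(_ isT).
  rewrite -addnA cE -/n => KF.
  have FE : F.@[tnth a] * (mmap1 (tnth a) c * g) =
      F@_b0 * (mmap1 (tnth a) b * g) +
      \sum_(b' <- msupp F | b' != b0) F@_b' * (mmap1 (tnth a) (b' + c)%MM * g).
    rewrite /meval /mmap (bigD1_seq b0) ?msupp_uniq ?mcoeff_msupp //= mulrDl mulr_suml.
    congr (_ + _); first by rewrite -[in RHS]bE addmC mmap1D; ring.
    by apply: eq_bigr => b' _; rewrite mmap1D; ring.
  rewrite -[_ * g]mul1r -uE -mulrA; apply: (idealM _ iW).
  rewrite -[F@_b0 * _](addrK (\sum_(b' <- msupp F | b' != b0) F@_b' * (mmap1 (tnth a) (b' + c)%MM * g))).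
  rewrite -FE; apply: (idealB iW); first by apply: BW; exact: KQB.
  rewrite big_seq_cond; apply: (ideal_sum _ iW) => b' /andP[b'F ne].
  have b'e : mdeg b' = e.
    by rewrite mcoeff_msupp in b'F; have [_ /(_ b'F) /andP[/eqP]] := F_form b'.
  have b'k : mdeg (b' + c)%MM = k by rewrite mdegD b'e addnC.
  have [lt|le] := ltP b' b0.
    apply: (idealM _ iW); apply: IH => //.
    by rewrite -bE addmC ltmc_add2r.
  apply: ZW; apply: mem_ideal_mul; last exact: monK.
  apply: contrapT => /maxb0; rewrite leNgt lt_neqAle eq_sym ne.
  by rewrite le.
have KW : ideal_exp K n.+1 `<=` W.
  move=> x; rewrite /n -addSn => /(reduction_power red).
  have := @ideal_mul_expE _ _ a 0 k _ (ideal_exp_ideal K r.+1); rewrite drop0 => ->.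
  move=> [g fg <-]; apply: (ideal_sum _ iW) => b _.
  have [->|nb] := eqVneq g@_b 0; first by rewrite mul0r; exact: ideal0.
  have [Kb /(_ nb) /andP[/eqP bk _]] := fg b.
  move: Kb; rewrite s1E => /ideal_genE [c ->]; rewrite mulr_suml.
  apply: (ideal_sum _ iW) => i _.
  have -> : c i * s1`_i * mmap1 (tnth a) b = c i * (mmap1 (tnth a) b * s1`_i) by ring.
  by apply: (idealM _ iW); apply: monW => //; exact: mem_nth.
have KB : ideal_exp K n.+1 `<=` B.
  rewrite s2E; apply: ideal_gen_min => // x.
  apply: (@nakayama R m im maximal_ideal_rad R^o s2 B iB) => {}x xs.
  have /KW [y By [z Zz xE]] : ideal_exp K n.+1 x by rewrite s2E; exact: sub_ideal_gen.
  move: Zz; rewrite s2E => /(ideal_mul_genE im) [c [mc zE]].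
  by exists c; split=> //; rewrite -xE zE addrK.
rewrite mulnA -sizeG.
apply: (@length_le_gen R R^o good (ideal_exp K r) (ideal_exp K n.+1)
  (ideal_mul K (ideal_exp Q n)) l) => //.
- exact: ideal_exp_ideal.
- by apply: ideal_mulS => //; exact: ideal_expS.
- move=> x /= /allpairsP [[f g] /= [fU gs ->]]; apply: monK => //.
  by move: fU; rewrite mem_enum finset.inE => /andP[/eqP].
- move=> x c /= xg Kc; apply: (reduction_annihilates iK red) => //.
  move/allpairsP: xg => [[f g] /= [fU gs ->]]; apply: monK => //.
  by move: fU; rewrite mem_enum finset.inE => /andP[/eqP].
Qed.

End Growth.

(** * Leading coefficients of Hilbert functions *)

Section Asymptotics.

Lemma ffact_lower n k : (n.+1 ^ k <= (n + k) ^_ k)%N.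
Proof.
elim: k => [|k IH]; first by rewrite ffactn0.
by rewrite addnS ffactSS expnS leq_mul // ltnS leq_addr.
Qed.

Lemma bin_lower d n : (0 < d)%N ->
  n.+1%:R ^+ d.-1 <= (d.-1)`!%:R * 'C(n + d - 1, d - 1)%:R :> rat.
Proof.
case: d => [//|d] _; rewrite -natrM -natrX ler_nat addnS !subn1 /= mulnC bin_ffact.
exact: ffact_lower.
Qed.

Lemma low_degree_bound (p : {poly rat}) d : (size p < d)%N ->
  exists C : rat, 0 <= C /\
  forall n : nat, `|p.[n%:R]| * n.+1%:R <= C * n.+1%:R ^+ d.-1.
Proof.
move=> szp; exists (\sum_(i < size p) `|p`_i|); split; first exact: sumr_ge0.
move=> n; rewrite horner_coef mulr_suml.
have n1 : (1 : rat) <= n.+1%:R by rewrite ler1n.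
apply: le_trans (_ : (\sum_(i < size p) `|p`_i * n%:R ^+ i|) * n.+1%:R <= _).
  by apply: ler_wpM2r => //; exact: ler_norm_sum.
rewrite mulr_suml; apply: ler_sum => i _; rewrite normrM -mulrA ler_wpM2l //.
rewrite normrX ger0_norm ?ler0n //.
apply: le_trans (_ : n.+1%:R ^+ i * n.+1%:R <= _).
  by apply: ler_wpM2r => //; apply: lerXn2r; rewrite ?nnegrE ?ler0n // ler_nat.
rewrite -exprSr; apply: ler_weXn2l => //.
by have := ltn_ord i; lia.
Qed.

(** The binomial coefficient is at least [(n+1)^(d-1) / (d-1)!], and for [n] large
    the polynomial of lower degree costs at most half of that. *)
Lemma hilbert_growth (t : int) (p : {poly rat}) d : (0 < d)%N -> (size p < d)%N ->
  0 < t -> exists c : rat, 0 < c /\ exists n1 : nat, forall n, (n1 <= n)%N ->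
  c * n.+1%:R ^+ d.-1 <= t%:~R * 'C(n + d - 1, d - 1)%:R + p.[n%:R].
Proof.
move=> d0 szp t0; have [C [C0 HC]] := low_degree_bound szp.
pose D : rat := (d.-1)`!%:R; have D0 : 0 < D by rewrite ltr0n fact_gt0.
exists (1 / (2 * D)); split; first by rewrite divr_gt0 // mulr_gt0.
exists (Num.bound (2 * D * C)) => n len.
set x : rat := n.+1%:R; set y := x ^+ d.-1; set b : rat := 'C(n + d - 1, d - 1)%:R.
have x0 : 0 < x by rewrite ltr0n.
have y0 : 0 < y by rewrite exprn_gt0.
have Cx : 2 * D * C <= x.
  have := archi_boundP (mulr_ge0 (mulr_ge0 (ler0n _ 2) (ltW D0)) C0).
  move/ltW/le_trans; apply; rewrite ler_nat; exact: leqW.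
have yb : y <= D * b by exact: bin_lower.
have b0 : 0 <= b by rewrite ler0n.
have tb : b <= t%:~R * b.
  by rewrite ler_peMl // (_ : 1 = 1%:~R) // ler_int.
have px : `|p.[n%:R]| * x <= C * y by exact: HC.
have pb : - `|p.[n%:R]| <= p.[n%:R] by rewrite lerNl ler_normr lexx orbT.
apply: le_trans (_ : b - `|p.[n%:R]| <= _); last by apply: lerD.
have P1 : `|p.[n%:R]| <= y / (2 * D).
  rewrite ler_pdivlMr ?mulr_gt0 // -(ler_pM2r x0).
  rewrite mulrAC; apply: le_trans (_ : C * y * (2 * D) <= _).
    by apply: ler_wpM2r => //; rewrite mulr_ge0 // ltW.
  by rewrite [C * y]mulrC -mulrA [C * _]mulrC ler_pM2l.
have P2 : y / D <= b by rewrite ler_pdivrMr // mulrC.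
have -> : 1 / (2 * D) * y = y / D - y / (2 * D) by field; rewrite gt_eqF.
by apply: lerB.
Qed.

Lemma hilbert_compare (t : int) (p : {poly rat}) d : (0 < d)%N -> (size p < d)%N ->
  (exists n0 : nat, forall n, (n0 <= n)%N ->
     t%:~R * 'C(n + d - 1, d - 1)%:R + p.[n%:R] <= 0 :> rat) -> t <= 0.
Proof.
move=> d0 szp [n0 H]; rewrite leNgt; apply/negP => t0.
have [c [c0 [n1 Hc]]] := hilbert_growth d0 szp t0.
have := le_trans (Hc _ (leq_maxl n1 n0)) (H _ (leq_maxr n1 n0)).
by rewrite leNgt mulr_gt0 // exprn_gt0 // ltr0n.
Qed.

(** The terms between [N] and [2N] alone add up to at least [c (N+1)^(d+1)]. *)
Lemma growth_contradiction (l : nat -> nat) (c : rat) (d n1 r A : nat) :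
  0 < c -> (forall n, (n1 <= n)%N -> c * n.+1%:R ^+ d <= (l n)%:R) ->
  ~ (forall N, n1 <= N -> exists cnt : nat -> nat,
      (forall k, (N <= k)%N -> (k <= N.*2)%N -> (l (r + k) <= cnt k)%N) /\
      (\sum_(k < N.*2.+1) cnt k <= A * N.*2.+1 ^ d)%N)%N.
Proof.
move=> c0 lc H.
pose N := maxn n1 (Num.bound ((A * 2 ^ d)%:R / c)).
have [cnt [lcnt sumcnt]] := H N (leq_maxl _ _).
have le1 : (\sum_(N <= k < N.*2.+1) cnt k <= A * N.*2.+1 ^ d)%N.
  apply: leq_trans sumcnt; rewrite -(big_mkord xpredT cnt).
  by rewrite (@big_cat_nat _ _ _ N 0 N.*2.+1) //= ?leq_addl // -addnn; lia.
have le2 : c * N.+1%:R ^+ d * N.+1%:R <= (\sum_(N <= k < N.*2.+1) cnt k)%:R :> rat.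
  rewrite natr_sum -[X in _ * X%:R]/(N.+1) .
  have -> : c * N.+1%:R ^+ d * N.+1%:R = \sum_(N <= k < N.*2.+1) c * N.+1%:R ^+ d :> rat.
    by rewrite sumr_const_nat mulr_natr; congr (_ *+ _); lia.
  rewrite !big_nat; apply: ler_sum => k /andP[leNk ltk].
  apply: le_trans (_ : (l (r + k))%:R <= _); last by rewrite ler_nat; apply: lcnt.
  apply: le_trans (lc (r + k)%N _); last first.
    by apply: leq_trans (leq_maxl _ _) (leq_trans leNk (leq_addl _ _)).
  rewrite ler_pM2l //; apply: lerXn2r; rewrite ?nnegrE ?ler0n // ler_nat ltnS.
  exact: leq_trans leNk (leq_addl _ _).
have le3 : (A * N.*2.+1 ^ d)%:R <= (A * 2 ^ d)%:R * N.+1%:R ^+ d :> rat.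
  rewrite -natrX -natrM ler_nat -mulnA leq_mul2l -expnMn.
  by apply/orP; right; case: (d) => // d'; rewrite leq_exp2r //; lia.
have lt4 : (A * 2 ^ d)%:R < c * N.+1%:R.
  rewrite mulrC -ltr_pdivrMr //.
  have := archi_boundP (divr_ge0 (ler0n rat (A * 2 ^ d)) (ltW c0)).
  move/lt_le_trans; apply; rewrite ler_nat.
  exact: leqW (leq_maxr _ _).
have := le_trans le2 (le_trans (_ : _ <= (A * N.*2.+1 ^ d)%:R) le3).
rewrite ler_nat => /(_ le1); apply/negP; rewrite -ltNge mulrAC.
by rewrite ltr_pM2r // exprn_gt0 // ltr0n.
Qed.

End Asymptotics.

(** * Extended Sally modules *)

Section Final.
Local Open Scope classical_set_scope.

Lemma ideal_mul_swap (R : comNzRingType) (J K L : set R) :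
  ideal_mul J (ideal_mul K L) `<=` ideal_mul K (ideal_mul J L).
Proof.
have iM := ideal_mul_ideal K (ideal_mul J L).
apply: ideal_mul_min => // x y Jx; move: y.
suff : ideal_mul K L `<=` [set y | ideal_mul K (ideal_mul J L) (x * y)] by exact.
apply: ideal_mul_min => [|u v Ku Lv /=].
  split; rewrite /=; first by rewrite mulr0; exact: (ideal0 iM).
    by move=> v w Ev Ew; rewrite mulrDr; exact: (idealD iM Ev Ew).
  by move=> c v Ev; rewrite -[c *: v]/(c * v) mulrCA; exact: (idealM _ iM Ev).
by rewrite mulrCA; apply: mem_ideal_mul => //; exact: mem_ideal_mul.
Qed.

Lemma reduction_succ (R : comNzRingType) (K Q : set R) r :
  ideal_exp K r.+1 = ideal_mul Q (ideal_exp K r) ->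
  ideal_exp K r.+2 = ideal_mul Q (ideal_exp K r.+1).
Proof.
move=> red; have -> : ideal_exp K r.+2 = ideal_mul K (ideal_exp K r.+1) by [].
rewrite {1}red; apply/seteqP; split; exact: ideal_mul_swap.
Qed.

Variables (R S : comNzRingType) (phi : {rmorphism R -> S}) (K Q : set R).
Hypothesis QK : Q `<=` K.

Lemma sally_den_sub n : ideal_mul K (ideal_exp Q n) `<=` ideal_exp K n.+1.
Proof. by apply: ideal_mulS => //; exact: ideal_expS. Qed.

Lemma sally_ext_length (s : seq (restr phi)) n l l' :
  span [set` s] = setT ->
  quot_length (ideal_exp (ideal_ext phi K) n.+1 : set (restr phi))
    (ideal_mul (ideal_ext phi K) (ideal_exp (ideal_ext phi Q) n)) l' ->
  length_le (ideal_exp K n.+1 : set R^o) (ideal_mul K (ideal_exp Q n) : set R^o) l ->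
  (l' <= size s * l)%N.
Proof.
rewrite -!ideal_ext_exp -ideal_ext_mul => sT hl' hl.
apply: (quot_length_ge hl'); apply: ext_length_le => //.
- exact: ideal_exp_ideal.
- exact: ideal_mul_ideal.
- exact: sally_den_sub.
Qed.

Lemma sally_multiplicity_le d nu (s sS : int) : (0 < d)%N ->
  min_number_generators (restr phi) nu -> sally_multiplicity d K Q s ->
  sally_multiplicity_ext phi d K Q sS -> sS <= nu%:Z * s.
Proof.
move=> d0 [[gs [<- gsT]] _] [p [szp [n0 Hp]]] [p' [szp' [n0' Hp']]].
rewrite -subr_le0; apply: (@hilbert_compare _ (p' - (size gs)%:R *: p) d) => //.
  apply: leq_ltn_trans (size_polyD _ _) _; rewrite gtn_max szp' size_polyN /=.
  exact: leq_ltn_trans (size_scale_leq _ _) szp.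
exists (maxn n0 n0') => n len.
have [l [hl lE]] := Hp n (leq_trans (leq_maxl _ _) len).
have [l' [hl' lE']] := Hp' n (leq_trans (leq_maxr _ _) len).
have le := sally_ext_length gsT hl' (quot_length_le hl).
rewrite hornerD hornerN hornerZ rmorphB /= rmorphM /= mulrBl addrACA -lE' -opprD.
have -> : ((size gs)%:Z)%:~R = (size gs)%:R :> rat by [].
by rewrite -mulrA -mulrDr -lE -natrM subr_le0 ler_nat.
Qed.

(** An annihilating form with a unit coefficient lowers the order of growth of the
    lengths below [n ^ (d - 1)], and [S] contributes only a constant factor. *)
Lemma sally_multiplicity_ext0 m d (a : d.-tuple R) r e (F : {mpoly R[d]}) (sS : int) :
  noetherian R -> local_ring m -> finite_morphism phi -> (0 < d)%N ->
  ideal K -> Q = ideal_gen [set` a] -> m `<=` radical K ->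
  ideal_exp K r.+2 = ideal_mul Q (ideal_exp K r.+1) ->
  form 0 e setT F -> (exists b, ~ m F@_b) -> sally_kills a K e F.@[tnth a] ->
  sally_multiplicity_ext phi d K Q sS -> sS = 0.
Proof.
move=> noethR localm [s sT] d0 iK QE mK red fF nF FK [p [szp [n0 Hp]]].
have QK' : ideal_gen [set` a] `<=` K by rewrite -QE.
have red' := red; rewrite QE in red'.
have [C [E growth]] := sally_growth noethR localm iK QK' (ltn0Sn r) red' mK fF nF FK.
have exl n : exists l : nat, (n0 <= n)%N ->
    quot_length (ideal_exp (ideal_ext phi K) n.+1 : set (restr phi))
      (ideal_mul (ideal_ext phi K) (ideal_exp (ideal_ext phi Q) n)) l /\
    l%:R = sS%:~R * 'C(n + d - 1, d - 1)%:R + p.[n%:R].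
  have [le|lt] := leqP n0 n; last by exists 0%N.
  by have [l Hl] := Hp n le; exists l.
have [l Hl] := choice exl.
apply/eqP; rewrite eq_le; apply/andP; split; last first.
  rewrite -oppr_le0; apply: (@hilbert_compare _ (- p) d); rewrite ?size_polyN //.
  exists n0 => n /Hl [_ lE]; rewrite hornerN rmorphN mulNr -opprD -lE.
  by rewrite oppr_le0 ler0n.
rewrite leNgt; apply/negP => sS0.
have [c [c0 [n1 Hc]]] := hilbert_growth d0 szp sS0.
apply: (@growth_contradiction l c d.-1 (maxn n0 n1) r.+1 (size s * C * E) c0).
  move=> n; rewrite geq_max => /andP[len0 len1].
  by have [_ ->] := Hl n len0; exact: Hc.
move=> N leN; have [cnt [Hcnt sumcnt]] := growth N.*2.
exists (fun k => size s * (cnt k * C))%N; split; last first.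
  rewrite -big_distrr /= -big_distrl /=.
  by rewrite -!mulnA leq_mul2l [(C * (E * _))%N]mulnC leq_mul2r sumcnt !orbT.
move=> k leNk lek2; apply: (sally_ext_length sT).
  have [|hl _] := Hl (r.+1 + k)%N; last exact: hl.
  apply: leq_trans (leq_trans leNk (leq_addl _ _)).
  exact: leq_trans (leq_maxl _ _) leN.
by rewrite QE; exact: Hcnt.
Qed.

End Final.

Unset Implicit Arguments.

(* Part (1) fails for a Cohen-Macaulay ring S with maximal ideals of height < d;
   as in the usual convention, it is about S of dimension d at each of its
   maximal ideals. *)
Theorem theorem2p6 (R : comNzRingType) (m : set R) (d : nat)
    (hnoeth : noetherian R) (hloc : local_ring m)
    (hdim : krull_dim R d) (hd : (1 <= d)%N)
    (S : comNzRingType) (phi : {rmorphism R -> S})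
    (hfin : finite_morphism phi) (hCM : cohen_macaulay S)
    (I Q : set R) (hI : primary_to m I) (hQ : minimal_reduction d I Q) :
  [/\ (forall P : set S, maximal_ideal P -> height P d) ->
      sally_dim_lt I Q d ->
      sally_zero (ideal_ext phi I) (ideal_ext phi Q),
      forall sS : int,
        sally_multiplicity_ext phi d I Q sS -> sS <> 0 ->
        sally_dim I Q d
    & forall (nu : nat) (s sS : int),
        min_number_generators (restr phi) nu ->
        sally_multiplicity d I Q s ->
        sally_multiplicity_ext phi d I Q sS ->
        sS <= nu%:Z * s].
Proof.
have [[iI _ _] radI] := hI; have [[a QE] QI [r red0]] := hQ.
have red := reduction_succ red0.
have mI : subset m (radical I) by rewrite radI.
have iQ : ideal Q by rewrite QE; exact: ideal_gen_ideal.
have Qm : subset Q m.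
  by move=> x /QI Ix; rewrite -radI; exists 1%N; rewrite expr1.
have [t mQ] : exists t, subset (ideal_exp m t) Q.
  apply: (radical_exp hnoeth (local_ideal hloc) iQ) => x /mI [k Ik].
  exists (k * r.+1)%N; rewrite exprM.
  have [|] := ideal_expX r.+1 r.+1 Ik; last by rewrite ltnn.
  by rewrite red0; exact: ideal_mul_subl.
have dichotomy := sally_chain_or_form a hloc I.
split.
- move=> htd dimlt; case: dichotomy => [chain|[e [F [fF nF FK]]]].
    by case: dimlt; rewrite QE.
  subst Q; apply: (sally_ext_zero hnoeth hloc hfin hCM htd iI QI Qm mQ fF nF).
  by move=> n x; exact: FK.
- move=> sS hsS sS0; split; last by move: red; rewrite QE => red; exact: (sally_dim_bound hloc iI red mI).
  case: dichotomy => [|[e [F [fF nF FK]]]]; first by rewrite QE.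
  case: sS0.
  exact: (sally_multiplicity_ext0 QI hnoeth hloc hfin hd iI QE mI red fF nF FK hsS).
- by move=> nu s sS; exact: sally_multiplicity_le.
Qed.
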